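(* Let $\mathcal C=\mathcal C_\pi$ be the continuous cluster category over a field $\mathbb k$. For any two clusters $\mathcal T_1,\mathcal T_2$ in $\mathcal C$ and any two objects $T_1\in\mathcal T_1$, $T_2\in\mathcal T_2$, there is an orientation preserving homeomorphism $\varphi$ of $S^1$ such that $\Phi_\varphi(\mathcal T_1)\cong\mathcal T_2$ (i.e. $\Phi_\varphi(\mathcal T_1)$ and $\mathcal T_2$ agree up to isomorphism of their objects) and $\Phi_\varphi(T_1)=T_2$.
   Context: Category $\mathcal C$. Let $R=\mathbb k[[t]]$, $S^1=\mathbb R/2\pi\mathbb Z$. $\mathcal P_{S^1}$ is the additive $R$-category with indecomposable objects $P_{[x]}$, $[x]\in S^1$, and a morphism $e^\alpha:P_{[x]}\to P_{[x+\alpha]}$ for every real $\alpha\ge 0$, with $e^\alpha e^\beta=e^{\alpha+\beta}$ and $e^{2\pi}=$ multiplication by $t$; $\mathrm{Hom}(P_{[x]},P_{[y]})$ is the free $R$-module of rank 1 generated by $e^\alpha$ with $\alpha\ge0$ smallest such that $[x+\alpha]=[y]$. $\mathcal F$ is the category of pairs $(V,d)$, $V\in\mathcal P_{S^1}$, $d\in\mathrm{End}(V)$, $d^2=t$, with morphisms those of $\mathcal P_{S^1}$ commuting with $d$; a sequence in $\mathcal F$ is exact if the underlying sequence in $\mathcal P_{S^1}$ is split exact. For $x\le y\le x+2\pi$ put $E(x,y)=\left(P_{[x]}\oplus P_{[y]},\begin{bmatrix}0&e^{x+2\pi-y}\\ e^{y-x}&0\end{bmatrix}\right)$; then $E(x,y)=E(x+2\pi,y+2\pi)$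 and $E(x,y)\cong E(y,x+2\pi)$. It is known that $\mathcal F$ is a Krull–Schmidt Frobenius category whose indecomposables are the objects isomorphic to some $E(x,y)$ and whose indecomposable projective-injectives are those isomorphic to some $E(x,x)$. $\mathcal C=\mathcal C_\pi$ is the stable category of $\mathcal F$, with its standard (Happel) triangulated structure. Its objects are taken to be finite ordered direct sums of the objects $E(x,y)$, $x<y<x+2\pi$. Isomorphism classes of indecomposables of $\mathcal C$ are unordered pairs of distinct points of $S^1$. Clusters. $\mathcal M$ is the set of isomorphism classes of indecomposables of $\mathcal C$ with the quotient topology from $\{(x,y)\in S^1\times S^1: x\ne y\}$ (an open Moebius band). Two indecomposables $X,Y$ are compatible if $\mathcal C(X,Y)=0$ or $\mathcal C(Y,X)=0$ or $X\cong Y$ (equivalently, the corresponding geodesics of the hyperbolic disc do not cross). A cluster is a subset of $\mathcal M$ (given by representatives $E(x,y)$, one for each class) that is maximal among sets of pairwise compatible elements and is discrete (every element has an open neighbourhood containing no other element of the set). For an orientation preserving homeomorphism $\varphi$ of $S^1$ with lift $\tilde\varphi:\mathbb R\to\mathbb R$, $\tilde\varphi(x+2\pi)=\tilde\varphi(x)+2\pi$, $\Phi_\varphi$ is the ($\mathbb k$-linear, triangulated) automorphism of $\mathcal C$ given on indecomposables by $\Phi_\varphi E(x,y)=E(\tilde\varphi(x),\tilde\varphi(y))$ and on morphisms by sending basic morphisms to basic morphisms (i.e. induced by $e^\alpha:P_{[x]}\to P_{[x+\alpha]}\ \mapsto\ e^{\tilde\varphi(x+\alpha)-\tilde\varphi(x)}:P_{[\tilde\varphi(x)]}\to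 P_{[\tilde\varphi(x+\alpha)]}$). *)

(* Defs.v *)
From HB Require Import structures.
From mathcomp Require Import all_boot all_order all_algebra generic_quotient.
From mathcomp Require Import all_classical all_reals all_analysis.
From mathcomp Require Import ring lra.
Import Order.TTheory GRing.Theory Num.Theory.
Import numFieldNormedType.Exports.

Set Implicit Arguments.
Unset Strict Implicit.
Unset Printing Implicit Defensive.

Local Open Scope classical_set_scope.
Local Open Scope ring_scope.
Local Open Scope quotient_scope.

(** Power series [k[[t]]], as coefficient sequences. *)
Definition fps (K : fieldType) : Type := nat -> K.

Section PowerSeries.
Variable K : fieldType.
Local Notation fpsK := (fps K).

HB.instance Definition _ := GRing.Zmodule.copy (fps K) (nat -> K).

Implicit Types a b c : fps K.

Definition fps_mul a b : fps K := fun n => \sum_(i < n.+1) a i * b (n - i)%N.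
Definition fps_one : fps K := fun n => (n == 0%N)%:R.
Definition fpsX : fps K := fun n => (n == 1%N)%:R.

Let trunc_fps n a : {poly K} := \poly_(i < n.+1) a i.

Let fps_mulE n a b m : (m <= n)%N ->
  fps_mul a b m = (trunc_fps n a * trunc_fps n b)`_m.
Proof.
move=> lemn; rewrite coefM; apply: eq_bigr => i _.
rewrite !coef_poly !ltnS (leq_trans _ lemn) ?(leq_trans (leq_subr _ _) lemn) //.
by rewrite -ltnS.
Qed.

Fact fps_mulA : associative fps_mul.
Proof.
move=> a b c; apply/funext => n.
have -> : fps_mul a (fps_mul b c) n
    = (trunc_fps n a * (trunc_fps n b * trunc_fps n c))`_n.
  rewrite coefM; apply: eq_bigr => i _.
  by rewrite coef_poly ltn_ord (fps_mulE b c (leq_subr i n)).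
rewrite mulrA coefM; apply: eq_bigr => i _.
by rewrite (@fps_mulE n) -1?ltnS // coef_poly ltnS leq_subr.
Qed.

Fact fps_mulC : commutative fps_mul.
Proof. by move=> a b; apply/funext => n; rewrite !(@fps_mulE n) // mulrC. Qed.

Fact fps_mul1 : left_id fps_one fps_mul.
Proof.
move=> a; apply/funext => n; rewrite /fps_mul big_ord_recl /= subn0 mul1r.
by rewrite big1 ?addr0 // => i _; rewrite mul0r.
Qed.

Fact fps_mulDl : left_distributive fps_mul +%R.
Proof.
move=> a b c; apply/funext => n; rewrite /fps_mul -[RHS]big_split /=.
by apply: eq_bigr => i _; rewrite -mulrDl.
Qed.

Fact fps_one_neq0 : fps_one != 0.
Proof. by apply/eqP => /(congr1 (@^~ 0%N))/eqP; rewrite /= oner_eq0. Qed.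

HB.instance Definition _ := GRing.Zmodule_isComNzRing.Build (fps K)
  fps_mulA fps_mulC fps_mul1 fps_mulDl fps_one_neq0.

End PowerSeries.

Arguments fpsX {K}.

Definition tau (R : realType) : R := 2 * pi.
Arguments tau {R}.

Lemma tau_gt0 (R : realType) : 0 < tau :> R.
Proof. by rewrite mulr_gt0 // pi_gt0. Qed.

Lemma tau_neq0 (R : realType) : tau != 0 :> R.
Proof. by rewrite gt_eqF // tau_gt0. Qed.

Definition cong2pi (R : realType) : rel R :=
  fun x y => (x - y) / tau \is a Num.int.

Section Circle.
Variable R : realType.

Fact cong2pi_refl : reflexive (@cong2pi R).
Proof. by move=> x; rewrite /cong2pi subrr mul0r rpred0. Qed.

Fact cong2pi_sym : symmetric (@cong2pi R).
Proof. by move=> x y; rewrite /cong2pi -opprB mulNr rpredN. Qed.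

Fact cong2pi_trans : transitive (@cong2pi R).
Proof.
move=> y x z; rewrite /cong2pi => xy yz.
by rewrite -(subrKA y) mulrDl rpredD.
Qed.

Canonical cong2pi_equiv :=
  EquivRel (@cong2pi R) cong2pi_refl cong2pi_sym cong2pi_trans.

Definition S1 : Type := quotient_topology {eq_quot cong2pi_equiv}.
HB.instance Definition _ := Topological.on S1.
HB.instance Definition _ := Quotient.on S1.

Definition cpt (x : R) : S1 := \pi_S1 x.

Lemma cptP (x y : R) : reflect (cpt x = cpt y) (cong2pi x y).
Proof. exact: (@eqmodP _ cong2pi_equiv). Qed.

Lemma cpt_repr (u : S1) : cpt (repr u) = u.
Proof. exact: reprK. Qed.

(** The representative of [a] modulo [2 pi] in [[0, 2 pi[]. *)
Definition rem2pi (a : R) : R := a - tau * (Num.floor (a / tau))%:~R.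

(** The least [a >= 0] such that [u + a = v] on the circle. *)
Definition arc_length (u v : S1) : R := rem2pi (repr v - repr u).

Lemma rem2pi_ge0 a : 0 <= rem2pi a.
Proof.
rewrite subr_ge0 mulrC -ler_pdivlMr ?tau_gt0 //; exact: floor_le.
Qed.

Lemma rem2pi_lt a : rem2pi a < tau.
Proof.
have := floorD1_gt (a / tau); rewrite ltr_pdivrMr ?tau_gt0 // intrD /rem2pi.
by rewrite ltrBlDr mulrDl mul1r mulrC [X in _ < X -> _]addrC.
Qed.


Lemma rem2pi_small a : 0 <= a -> a < tau -> rem2pi a = a.
Proof.
move=> a0 a1; rewrite /rem2pi (@floor_def _ _ 0) ?mulr0 ?subr0 //.
by rewrite add0r divr_ge0 ?(ltW (tau_gt0 R)) //= ltr_pdivrMr ?tau_gt0 // mul1r.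
Qed.

Lemma rem2piD a (n : int) : rem2pi (a + tau * n%:~R) = rem2pi a.
Proof.
have E : (a + tau * n%:~R) / tau = a / tau + n%:~R.
  by field; exact: tau_neq0.
rewrite /rem2pi E floorDrz ?intr_int // intrKfloor intrD; ring.
Qed.

Lemma rem2pi_rem a b : rem2pi (rem2pi a + b) = rem2pi (a + b).
Proof.
rewrite -(rem2piD (a + b) (- Num.floor (a / tau))); congr rem2pi.
rewrite /rem2pi mulrNz; ring.
Qed.

Lemma repr_cpt x : exists n : int, repr (cpt x) = x + tau * n%:~R.
Proof.
have /cptP : cpt (repr (cpt x)) = cpt x by rewrite cpt_repr.
case/intrP=> n E; exists n; apply/eqP; rewrite addrC -subr_eq -E.
by apply/eqP; field; exact: tau_neq0.
Qed.

Lemma arc_length_cpt x y : arc_length (cpt x) (cpt y) = rem2pi (y - x).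
Proof.
rewrite /arc_length; have [n ->] := repr_cpt x; have [m ->] := repr_cpt y.
rewrite -(rem2piD (y - x) (m - n)); congr rem2pi; rewrite mulrzBr; ring.
Qed.

Lemma arc_length_ge0 u v : 0 <= arc_length u v.
Proof. exact: rem2pi_ge0. Qed.

Lemma arc_length_lt u v : arc_length u v < tau.
Proof. exact: rem2pi_lt. Qed.

Lemma arc_length_trans u v w :
  rem2pi (arc_length u v + arc_length v w) = arc_length u w.
Proof.
by rewrite rem2pi_rem addrC rem2pi_rem addrC; congr rem2pi; ring.
Qed.

Lemma arc_lengthxx u : arc_length u u = 0.
Proof. by rewrite /arc_length subrr rem2pi_small // tau_gt0. Qed.

Lemma arc_lengthK u v : cpt (repr u + arc_length u v) = v.
Proof.
rewrite -[RHS]cpt_repr; apply/cptP/intrP.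
exists (- Num.floor ((repr v - repr u) / tau)).
by rewrite /arc_length /rem2pi mulrNz; field; exact: tau_neq0.
Qed.

End Circle.

(** The additive category [P_{S^1}] is encoded by coordinates.  An object is a
  finite ordered sum of the [P_u], [u : S1]; [Hom(P_u, P_v)] is free of rank one
  over [k[[t]]] on [e^a] with [a := arc_length u v], and a morphism is the matrix
  of the coordinates of its components on these generators (row = target). *)

(** Coordinate of [e^a], [a >= 0], on that generator: if [a = b + 2 pi n] with
  [0 <= b < 2 pi] then [e^a = t^n e^b]. *)
Definition ebasic (K : fieldType) (R : realType) (a : R) : fps K :=
  fpsX ^+ Num.truncn (a / tau).
Arguments ebasic {K R}.

Record pobj (R : realType) := PObj { rk : nat ; summand : 'I_rk -> S1 R }.

Definition phom (K : fieldType) (R : realType) (V W : pobj R) : Type :=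
  'M[fps K]_(rk W, rk V).

Section PCategory.
Variables (K : fieldType) (R : realType).
Implicit Types U V W : pobj R.
Local Notation phom := (@phom K R).

HB.instance Definition _ V W :=
  GRing.Lmodule.copy (phom V W) 'M[fps K]_(rk W, rk V).

Lemma ebasic_small (a : R) : a < tau -> ebasic a = 1 :> fps K.
Proof.
move=> a1; rewrite /ebasic (elimT (@truncn0Pn _ _)) // -ltNge.
by rewrite ltr_pdivrMr ?tau_gt0 // mul1r.
Qed.

Lemma ebasic_tau : ebasic (tau : R) = fpsX :> fps K.
Proof. by rewrite /ebasic divff ?tau_neq0 // truncn1. Qed.

Lemma ebasicD (a b : R) : 0 <= a -> 0 <= b ->
  ebasic a * ebasic b * ebasic (rem2pi a + rem2pi b) = ebasic (a + b) :> fps K.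
Proof.
have E (c : R) : 0 <= c -> rem2pi c = c - tau * (Num.truncn (c / tau))%:R.
  move=> c0; have c1 : 0 <= c / tau by rewrite divr_ge0 ?(ltW (tau_gt0 R)).
  rewrite /rem2pi truncn_floor c1 -[X in X%:~R]gez0_abs ?floor_ge0 //.
move=> a0 b0; rewrite /ebasic -!exprD.
set p := Num.truncn (a / tau); set q := Num.truncn (b / tau); congr (_ ^+ _).
have -> : (a + b) / tau = (p + q)%:R + (rem2pi a + rem2pi b) / tau.
  rewrite !E // -/p -/q natrD; field; exact: tau_neq0.
rewrite [in RHS]truncnD ?natr_nat ?natrK //.
rewrite nnegrE; apply: divr_ge0; last exact/ltW/tau_gt0.
by apply: addr_ge0; exact: rem2pi_ge0.
Qed.

(** Matrix product, twisted because [e^b e^a = e^(a + b)] need not be the chosen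
  generator. *)
Definition pcomp U V W (g : phom V W) (f : phom U V) : phom U W :=
  \matrix_(i, j) \sum_(l < rk V) g i l * f l j *
    ebasic (arc_length (summand j) (summand l)
            + arc_length (summand l) (summand i)).

Definition pid V : phom V V := 1%:M.

Let cocycle (u v w z : S1 R) :
  ebasic (arc_length u v + arc_length v w) *
  ebasic (arc_length u w + arc_length w z) =
  ebasic (arc_length v w + arc_length w z) *
  ebasic (arc_length u v + arc_length v z) :> fps K.
Proof.
have al (u' v' : S1 R) : 0 <= arc_length u' v' by exact: arc_length_ge0.
have H (a b c : R) : 0 <= a -> 0 <= b -> 0 <= c -> c < tau ->
    ebasic (a + b) * ebasic (rem2pi (a + b) + c) = ebasic (a + b + c) :> fps K.
  move=> a0 b0 c0 c1; rewrite -(ebasicD (addr_ge0 a0 b0) c0) (rem2pi_small c0) //.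
  by rewrite (ebasic_small c1) mulr1.
rewrite -(arc_length_trans u v w) -(arc_length_trans v w z).
rewrite H ?al ?arc_length_lt // [in X in _ = _ * X]addrC.
by rewrite H ?al ?arc_length_lt //; congr ebasic; ring.
Qed.

Lemma pcompA U V W Z (h : phom W Z) (g : phom V W) (f : phom U V) :
  pcomp h (pcomp g f) = pcomp (pcomp h g) f.
Proof.
apply/matrixP => i j; rewrite !mxE.
under eq_bigr do rewrite mxE mulr_sumr mulr_suml.
under [RHS]eq_bigr do rewrite mxE !mulr_suml.
rewrite exchange_big; apply: eq_bigr => l _; apply: eq_bigr => m _ /=.
set a := (X in h i m * (_ * X) * _); set b := (X in _ * X = _).
set c := (X in _ = h i m * _ * X * _ * _); set d := (X in _ = _ * X).
have E : a * b = c * d by exact: cocycle.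
transitivity (h i m * g m l * f l j * (a * b)); first by ring.
by rewrite E; ring.
Qed.

Lemma pcomp1f U V (f : phom U V) : pcomp (pid V) f = f.
Proof.
apply/matrixP => i j; rewrite !mxE (bigD1 i) //= big1 => [|l /negPf li].
  rewrite mxE eqxx mul1r arc_lengthxx !addr0 ebasic_small ?mulr1 //.
  exact: arc_length_lt.
by rewrite mxE eq_sym li !mul0r.
Qed.

Lemma pcompf1 U V (f : phom U V) : pcomp f (pid U) = f.
Proof.
apply/matrixP => i j; rewrite !mxE (bigD1 j) //= big1 => [|l /negPf lj].
  rewrite mxE eqxx mulr1 arc_lengthxx addr0 add0r ebasic_small ?mulr1 //.
  exact: arc_length_lt.
by rewrite mxE lj mulr0 mul0r.
Qed.

Lemma pcompDl U V W (g g' : phom V W) (f : phom U V) :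
  pcomp (g + g') f = pcomp g f + pcomp g' f.
Proof.
apply/matrixP => i j; rewrite !mxE -big_split; apply: eq_bigr => l _ /=.
by rewrite mxE !mulrDl.
Qed.

Lemma pcompDr U V W (g : phom V W) (f f' : phom U V) :
  pcomp g (f + f') = pcomp g f + pcomp g f'.
Proof.
apply/matrixP => i j; rewrite !mxE -big_split; apply: eq_bigr => l _ /=.
by rewrite mxE mulrDr !mulrDl.
Qed.

Lemma pcompZl U V W r (g : phom V W) (f : phom U V) :
  pcomp (r *: g) f = r *: pcomp g f.
Proof.
apply/matrixP => i j; rewrite !mxE mulr_sumr; apply: eq_bigr => l _.
by rewrite mxE !mulrA.
Qed.

Lemma pcompZr U V W r (g : phom V W) (f : phom U V) :
  pcomp g (r *: f) = r *: pcomp g f.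
Proof.
apply/matrixP => i j; rewrite !mxE mulr_sumr; apply: eq_bigr => l _.
by rewrite mxE [g i l * _]mulrCA !mulrA.
Qed.

End PCategory.

Arguments pid {K R}.

(** Objects [(V, d)], [d^2 = t], of the Frobenius category F. *)
Record fobj (K : fieldType) (R : realType) := FObj {
  carrier :> pobj R ;
  fdiff : phom K carrier carrier ;
  diff_sqr : pcomp fdiff fdiff = fpsX *: pid carrier }.

Section FCategory.
Variables (K : fieldType) (R : realType).
Implicit Types X Y Z P : fobj K R.
Local Notation phom := (@phom K R).

Definition fmor X Y (f : phom X Y) : Prop :=
  pcomp f (fdiff X) = pcomp (fdiff Y) f.

Definition split_exact (U V W : pobj R) (i : phom U V) (p : phom V W) : Prop :=
  exists (r : phom V U) (s : phom W V),
    [/\ pcomp p i = 0, pcomp r i = pid U, pcomp p s = pid W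
      & pcomp i r + pcomp s p = pid V].

Definition fexact X Y Z (i : phom X Y) (p : phom Y Z) : Prop :=
  [/\ fmor i, fmor p & split_exact i p].

Definition fprojective P : Prop :=
  forall X Y Z (i : phom X Y) (p : phom Y Z), fexact i p ->
  forall f : phom P Z, fmor f -> exists2 g : phom P Y, fmor g & pcomp p g = f.

Definition finjective P : Prop :=
  forall X Y Z (i : phom X Y) (p : phom Y Z), fexact i p ->
  forall f : phom X P, fmor f -> exists2 g : phom Y P, fmor g & pcomp g i = f.

(** The category C is the stable category of F: morphisms of F modulo those that
  factor through a projective-injective object.  [stable_hom0 X Y] says that
  [C(X, Y) = 0] and [stable_iso X Y] that [X] and [Y] are isomorphic in C. *)

Definition stably_null X Y (f : phom X Y) : Prop :=
  exists P, [/\ fprojective P, finjective P &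
    exists (g : phom X P) (h : phom P Y), [/\ fmor g, fmor h & f = pcomp h g]].

Definition stable_hom0 X Y : Prop :=
  forall f : phom X Y, fmor f -> stably_null f.

Definition stable_iso X Y : Prop :=
  exists (f : phom X Y) (g : phom Y X), [/\ fmor f, fmor g,
    stably_null (pcomp g f - pid X) & stably_null (pcomp f g - pid Y)].

Lemma fmor_id X : fmor (pid X : phom X X).
Proof. by rewrite /fmor pcomp1f pcompf1. Qed.

Lemma fmor_comp X Y Z (g : phom Y Z) (f : phom X Y) :
  fmor g -> fmor f -> fmor (pcomp g f).
Proof. by rewrite /fmor => gd fd; rewrite -pcompA fd pcompA gd pcompA. Qed.

Definition psum (V W : pobj R) : pobj R := PObj (fun i : 'I_(rk V + rk W) =>
  match fintype.split i with inl j => summand j | inr j => summand j end).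

Definition pinl (V W : pobj R) : phom V (psum V W) := col_mx 1%:M 0.
Definition pinr (V W : pobj R) : phom W (psum V W) := col_mx 0 1%:M.
Definition pfst (V W : pobj R) : phom (psum V W) V := row_mx 1%:M 0.
Definition psnd (V W : pobj R) : phom (psum V W) W := row_mx 0 1%:M.

Let summandl (V W : pobj R) i :
  @summand _ (psum V W) (lshift _ i) = summand i.
Proof. by rewrite /= -[lshift _ _]/(unsplit (inl i)) unsplitK. Qed.

Let summandr (V W : pobj R) i :
  @summand _ (psum V W) (rshift _ i) = summand i.
Proof. by rewrite /= -[rshift _ _]/(unsplit (inr i)) unsplitK. Qed.

Let pcomp_row_col (U V W Z : pobj R)
    (a : phom V Z) (b : phom W Z) (c : phom U V) (d : phom U W) :
  pcomp (row_mx a b : phom (psum V W) Z) (col_mx c d : phom U (psum V W))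
  = pcomp a c + pcomp b d.
Proof.
apply/matrixP => i j; rewrite !mxE big_split_ord; congr (_ + _);
  apply: eq_bigr => l _.
- by rewrite row_mxEl col_mxEu summandl.
- by rewrite row_mxEr col_mxEd summandr.
Qed.

Let pcomp_col_row (V W Z : pobj R)
    (a : phom Z V) (b : phom Z W) (c : phom V Z) (d : phom W Z) :
  pcomp (col_mx a b : phom Z (psum V W)) (row_mx c d : phom (psum V W) Z)
  = block_mx (pcomp a c) (pcomp a d) (pcomp b c) (pcomp b d).
Proof.
apply/matrixP => i j.
case: (fintype.splitP i) => k /= ik; case: (fintype.splitP j) => l /= jl.
- have -> : i = lshift _ k by exact: val_inj.
  have -> : j = lshift _ l by exact: val_inj.
  rewrite block_mxEul !mxE; apply: eq_bigr => m _.
  by rewrite col_mxEu row_mxEl !summandl.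
- have -> : i = lshift _ k by exact: val_inj.
  have -> : j = rshift _ l by exact: val_inj.
  rewrite block_mxEur !mxE; apply: eq_bigr => m _.
  by rewrite col_mxEu row_mxEr summandl summandr.
- have -> : i = rshift _ k by exact: val_inj.
  have -> : j = lshift _ l by exact: val_inj.
  rewrite block_mxEdl !mxE; apply: eq_bigr => m _.
  by rewrite col_mxEd row_mxEl summandl summandr.
- have -> : i = rshift _ k by exact: val_inj.
  have -> : j = rshift _ l by exact: val_inj.
  rewrite block_mxEdr !mxE; apply: eq_bigr => m _.
  by rewrite col_mxEd row_mxEr !summandr.
Qed.

Lemma pcomp0l (U V W : pobj R) (f : phom U V) : pcomp (0 : phom V W) f = 0.
Proof. by rewrite -(scale0r (0 : phom V W)) pcompZl scale0r. Qed.

Lemma pcomp0r (U V W : pobj R) (g : phom V W) : pcomp g (0 : phom U V) = 0.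
Proof. by rewrite -(scale0r (0 : phom U V)) pcompZr scale0r. Qed.

Lemma pcompNl (U V W : pobj R) (g : phom V W) (f : phom U V) :
  pcomp (- g) f = - pcomp g f.
Proof. by rewrite -scaleN1r pcompZl scaleN1r. Qed.

Lemma pcompNr (U V W : pobj R) (g : phom V W) (f : phom U V) :
  pcomp g (- f) = - pcomp g f.
Proof. by rewrite -scaleN1r pcompZr scaleN1r. Qed.

Lemma pfst_inl (V W : pobj R) : pcomp (pfst V W) (pinl V W) = pid V.
Proof. by rewrite [LHS]pcomp_row_col pcomp0l addr0 [LHS]pcomp1f. Qed.

Lemma psnd_inr (V W : pobj R) : pcomp (psnd V W) (pinr V W) = pid W.
Proof. by rewrite [LHS]pcomp_row_col pcomp0l add0r [LHS]pcomp1f. Qed.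

Lemma pfst_inr (V W : pobj R) : pcomp (pfst V W) (pinr V W) = 0.
Proof. by rewrite [LHS]pcomp_row_col pcomp0l pcomp0r addr0. Qed.

Lemma psnd_inl (V W : pobj R) : pcomp (psnd V W) (pinl V W) = 0.
Proof. by rewrite [LHS]pcomp_row_col pcomp0l pcomp0r addr0. Qed.

Lemma pinl_fst_inr_snd (V W : pobj R) :
  pcomp (pinl V W) (pfst V W) + pcomp (pinr V W) (psnd V W)
  = pid (psum V W).
Proof.
rewrite [X in X + _]pcomp_col_row [X in _ + X]pcomp_col_row.
rewrite !pcomp0l !pcomp0r -[1%:M]/(pid _) !pcomp1f.
rewrite [LHS]add_block_mx !addr0 !add0r.
by rewrite [RHS]/pid [RHS]scalar_mx_block.
Qed.

Definition sum_diff X Y : phom (psum X Y) (psum X Y) :=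
  pcomp (pinl X Y) (pcomp (fdiff X) (pfst X Y))
  + pcomp (pinr X Y) (pcomp (fdiff Y) (psnd X Y)).

Let sum_diff_inl X Y : pcomp (sum_diff X Y) (pinl X Y) = pcomp (pinl X Y) (fdiff X).
Proof.
by rewrite pcompDl -!pcompA pfst_inl psnd_inl !pcomp0r pcompf1 addr0.
Qed.

Let sum_diff_inr X Y : pcomp (sum_diff X Y) (pinr X Y) = pcomp (pinr X Y) (fdiff Y).
Proof.
by rewrite pcompDl -!pcompA pfst_inr psnd_inr !pcomp0r pcompf1 add0r.
Qed.

Let fst_sum_diff X Y : pcomp (pfst X Y) (sum_diff X Y) = pcomp (fdiff X) (pfst X Y).
Proof.
by rewrite pcompDr !pcompA pfst_inl pfst_inr !pcomp0l pcomp1f addr0.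
Qed.

Let snd_sum_diff X Y : pcomp (psnd X Y) (sum_diff X Y) = pcomp (fdiff Y) (psnd X Y).
Proof.
by rewrite pcompDr !pcompA psnd_inl psnd_inr !pcomp0l pcomp1f add0r.
Qed.

Fact sum_diff_sqr X Y :
  pcomp (sum_diff X Y) (sum_diff X Y) = fpsX *: pid (psum X Y).
Proof.
rewrite {2}/sum_diff pcompDr !(pcompA (sum_diff _ _)) sum_diff_inl sum_diff_inr.
rewrite -!pcompA !(pcompA (fdiff _)) !diff_sqr !pcompZl !pcompZr !pcomp1f.
by rewrite -scalerDr pinl_fst_inr_snd.
Qed.

Definition fsum X Y : fobj K R := FObj (sum_diff_sqr X Y).

Lemma projective_sum P Q : fprojective P -> fprojective Q -> fprojective (fsum P Q).
Proof.
move=> pP pQ X Y Z i p ex.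
suff H (f : phom (psum P Q) Z) : pcomp f (sum_diff P Q) = pcomp (fdiff Z) f ->
    exists2 g : phom (psum P Q) Y,
      pcomp g (sum_diff P Q) = pcomp (fdiff Y) g & pcomp p g = f by exact: H.
move=> fd.
have [|g gm gE] := pP _ _ _ _ _ ex (pcomp f (pinl P Q)).
  by rewrite /fmor -pcompA -sum_diff_inl pcompA fd pcompA.
have [|h hm hE] := pQ _ _ _ _ _ ex (pcomp f (pinr P Q)).
  by rewrite /fmor -pcompA -sum_diff_inr pcompA fd pcompA.
exists (pcomp g (pfst P Q) + pcomp h (psnd P Q)).
  rewrite pcompDl -!pcompA fst_sum_diff snd_sum_diff.
  by rewrite pcompDr !pcompA gm hm.
by rewrite pcompDr !pcompA gE hE -!pcompA -pcompDr pinl_fst_inr_snd pcompf1.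
Qed.

Lemma injective_sum P Q : finjective P -> finjective Q -> finjective (fsum P Q).
Proof.
move=> pP pQ X Y Z i p ex.
suff H (f : phom X (psum P Q)) : pcomp f (fdiff X) = pcomp (sum_diff P Q) f ->
    exists2 g : phom Y (psum P Q),
      pcomp g (fdiff Y) = pcomp (sum_diff P Q) g & pcomp g i = f by exact: H.
move=> fd.
have [|g gm gE] := pP _ _ _ _ _ ex (pcomp (pfst P Q) f).
  by rewrite /fmor -pcompA fd !pcompA fst_sum_diff.
have [|h hm hE] := pQ _ _ _ _ _ ex (pcomp (psnd P Q) f).
  by rewrite /fmor -pcompA fd !pcompA snd_sum_diff.
exists (pcomp (pinl P Q) g + pcomp (pinr P Q) h).
  rewrite pcompDr !pcompA sum_diff_inl sum_diff_inr.
  by rewrite pcompDl -!pcompA gm hm.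
by rewrite pcompDl -!pcompA gE hE !pcompA -pcompDl pinl_fst_inr_snd pcomp1f.
Qed.

Lemma stably_null0 X Y : stably_null (0 : phom X Y).
Proof.
pose V0 := PObj (fun _ : 'I_0 => cpt (0 : R)).
have E (f g : phom V0 V0) : f = g by apply/matrixP => -[].
pose O : fobj K R := FObj (E (pcomp 0 0) _).
have O0 (V : pobj R) (f : phom V O) : f = 0 by apply/matrixP => -[].
have O1 (V : pobj R) (f : phom O V) : f = 0 by apply/matrixP => i -[].
exists O; split.
- move=> A B Z i p _ f _; exists 0; last by rewrite [RHS]O1 pcomp0r.
  by rewrite /fmor pcomp0l pcomp0r.
- move=> A B Z i p _ f _; exists 0; last by rewrite [RHS]O0 pcomp0l.
  by rewrite /fmor pcomp0l pcomp0r.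
by exists 0, 0; split; rewrite /fmor ?pcomp0l ?pcomp0r.
Qed.

Lemma stably_nullD X Y (f g : phom X Y) :
  stably_null f -> stably_null g -> stably_null (f + g).
Proof.
move=> [P [pP iP [a [b [am bm ->]]]]] [Q [pQ iQ [c [d [cm dm ->]]]]].
exists (fsum P Q); split; [exact: projective_sum|exact: injective_sum|].
pose k : phom X (psum P Q) := pcomp (pinl P Q) a + pcomp (pinr P Q) c.
pose h : phom (psum P Q) Y := pcomp b (pfst P Q) + pcomp d (psnd P Q).
have km : pcomp k (fdiff X) = pcomp (sum_diff P Q) k.
  rewrite pcompDr !pcompA sum_diff_inl sum_diff_inr.
  by rewrite pcompDl -!pcompA am cm.
have hm : pcomp h (sum_diff P Q) = pcomp (fdiff Y) h.
  rewrite pcompDl -!pcompA fst_sum_diff snd_sum_diff.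
  by rewrite pcompDr !pcompA bm dm.
exists k, h; split=> //; rewrite -[RHS]/(pcomp h k).
rewrite pcompDr !pcompDl -!pcompA !(pcompA (pfst _ _)) !(pcompA (psnd _ _)).
rewrite pfst_inl pfst_inr psnd_inl psnd_inr !pcomp0l !pcomp0r !pcomp1f.
by rewrite addr0 add0r.
Qed.

Lemma stably_null_comp X Y Z (W : fobj K R) (h : phom Z W) (g : phom Y Z) (f : phom X Y) :
  fmor h -> fmor f -> stably_null g -> stably_null (pcomp h (pcomp g f)).
Proof.
move=> hm fm [P [pP iP [a [b [am bm ->]]]]]; exists P; split=> //.
exists (pcomp a f), (pcomp h b); split; [exact: fmor_comp|exact: fmor_comp|].
by rewrite !pcompA.
Qed.

Lemma stable_iso_refl X : stable_iso X X.
Proof.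
have N : stably_null (pcomp (pid X) (pid X) - pid X : phom X X).
  by rewrite pcomp1f subrr; exact: stably_null0.
by exists (pid X), (pid X); split=> //; exact: fmor_id.
Qed.

Lemma stable_iso_sym X Y : stable_iso X Y -> stable_iso Y X.
Proof. by move=> [f [g [fm gm n1 n2]]]; exists g, f; split. Qed.

Lemma stable_iso_trans X Y Z : stable_iso X Y -> stable_iso Y Z -> stable_iso X Z.
Proof.
move=> [f [g [fm gm n1 n2]]] [f' [g' [fm' gm' n1' n2']]].
exists (pcomp f' f), (pcomp g g'); split; try exact: fmor_comp.
- have -> : pcomp (pcomp g g') (pcomp f' f) - pid X
      = pcomp g (pcomp (pcomp g' f' - pid Y) f) + (pcomp g f - pid X).
    rewrite pcompDl pcompNl pcomp1f pcompDr pcompNr !pcompA.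
    by rewrite addrA addrNK.
  by apply: stably_nullD => //; exact: stably_null_comp.
- have -> : pcomp (pcomp f' f) (pcomp g g') - pid Z
      = pcomp f' (pcomp (pcomp f g - pid Y) g') + (pcomp f' g' - pid Z).
    rewrite pcompDl pcompNl pcomp1f pcompDr pcompNr !pcompA.
    by rewrite addrA addrNK.
  by apply: stably_nullD => //; exact: stably_null_comp.
Qed.

End FCategory.

Section EObjects.
Variables (K : fieldType) (R : realType).
Implicit Types x y : R.

Definition E_carrier x y : pobj R :=
  PObj (fun i : 'I_2 => if i == 0 then cpt x else cpt y).

Definition E_diff x y : phom K (E_carrier x y) (E_carrier x y) :=
  \matrix_(i, j) if i == j then 0
                 else if i == 0 then ebasic (x + tau - y) else ebasic (y - x).

Fact E_diff_sqr x y : x <= y <= x + tau ->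
  pcomp (E_diff x y) (E_diff x y) = fpsX *: pid (E_carrier x y).
Proof.
move=> /andP[xy yx].
have a0 : 0 <= y - x by rewrite subr_ge0.
have b0 : 0 <= x + tau - y by rewrite subr_ge0.
have rab : arc_length (cpt x) (cpt y) = rem2pi (y - x) by exact: arc_length_cpt.
have rba : arc_length (cpt y) (cpt x) = rem2pi (x + tau - y).
  rewrite arc_length_cpt -(rem2piD (x - y) 1) mulr1; congr rem2pi; ring.
have ab : y - x + (x + tau - y) = tau by ring.
apply/matrixP => i j; rewrite !mxE !big_ord_recl big_ord0 addr0 !mxE.
have [i0 j0] : (i = 0 \/ i = 1) /\ (j = 0 \/ j = 1).
  by split; [case: i|case: j] => -[|[|//]] ?; ((by left; exact: val_inj) ||
    (by right; exact: val_inj)).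
case: i0 => ->; case: j0 => -> /=; rewrite ?mulr0 ?mul0r ?addr0 ?add0r ?mulr1 //=.
- by rewrite rab rba [X in X * _]mulrC ebasicD // ab ebasic_tau.
- by rewrite rab rba [rem2pi _ + _]addrC ebasicD // ab ebasic_tau.
Qed.

Definition E x y (h : x <= y <= x + tau) : fobj K R := FObj (E_diff_sqr h).


Lemma fobj_eq n (s s' : 'I_n -> S1 R) (d d' : 'M[fps K]_n) e e' :
  s = s' -> d = d' -> @FObj K R (PObj s) d e = @FObj K R (PObj s') d' e'.
Proof. by move=> ss dd; subst s' d'; congr FObj; exact: Prop_irrelevance. Qed.

Lemma E_eq x y x' y' (h : x <= y <= x + tau) (h' : x' <= y' <= x' + tau) :
  cpt x = cpt x' -> y - x = y' - x' -> E h = E h'.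
Proof.
move=> xx xy; apply: fobj_eq.
  have yy : cpt y = cpt y'.
    have /cptP/intrP[n H] := xx; apply/cptP/intrP; exists n; rewrite -H.
    by congr (_ / _); lra.
  by apply/funext => i; case: ifP.
have -> : y' = x' + (y - x) by lra.
apply/matrixP => i j; rewrite !mxE; case: ifP => // _; case: ifP => _;
  congr ebasic; lra.
Qed.

Fact E_pair_bounds (p : S1 R * S1 R) (x := repr p.1) :
  x <= x + arc_length p.1 p.2 <= x + tau.
Proof. by rewrite lerDl arc_length_ge0 lerD2l ltW ?arc_length_lt. Qed.

(** [E(x, y)] as a function of the points [[x]] and [[y]], for [x < y < x + 2 pi]
    (see [E_pairE]). *)
Definition E_pair (p : S1 R * S1 R) : fobj K R := E (E_pair_bounds p).

Lemma E_pairE x y (h : x <= y <= x + tau) : y < x + tau ->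
  E_pair (cpt x, cpt y) = E h.
Proof.
move=> yx; apply: E_eq; rewrite /= ?cpt_repr //.
have /andP[h0 _] := h.
by rewrite arc_length_cpt rem2pi_small ?subr_ge0 // ?ltrBlDl //; ring.
Qed.

End EObjects.

(** Orientation preserving homeomorphisms of the circle, with a chosen lift to
  the line; two lifts differ by a multiple of [2 pi], which does not affect
  [Phi] below. *)
Record circle_homeo (R : realType) := CircleHomeo {
  homeo_map :> S1 R -> S1 R ;
  homeo_lift : R -> R ;
  homeo_continuous : continuous homeo_map ;
  homeo_inverse : exists g : S1 R -> S1 R,
    [/\ continuous g, cancel homeo_map g & cancel g homeo_map] ;
  lift_continuous : continuous homeo_lift ;
  lift_increasing : {homo homeo_lift : x y / x < y} ;
  lift_tau : forall x, homeo_lift (x + tau) = homeo_lift x + tau ;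
  lift_cpt : forall x, homeo_map (cpt x) = cpt (homeo_lift x) }.

Section Phi.
Variables (K : fieldType) (R : realType) (phi : circle_homeo R).
Implicit Types U V W : pobj R.
Local Notation phom := (@phom K R).
Local Notation lift := (homeo_lift phi).

Definition Phi_pobj V : pobj R := PObj (fun i => phi (@summand R V i)).

(** [r * e^a : P_[x] -> P_[x + a]] goes to
    [r * e^(lift (x + a) - lift x) : P_[lift x] -> P_[lift (x + a)]]. *)
Definition Phi_phom V W (f : phom V W) : phom (Phi_pobj V) (Phi_pobj W) :=
  \matrix_(i, j)
    let x := repr (@summand R V j) in
    let a := arc_length (@summand R V j) (@summand R W i) in
    f i j * ebasic (lift (x + a) - lift x).

Let lift_le x y : x <= y -> lift x <= lift y.
Proof. by rewrite le_eqVlt => /predU1P[->//|/(lift_increasing phi)/ltW]. Qed.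

Let liftDn x (n : nat) : lift (x + tau * n%:R) = lift x + tau * n%:R.
Proof.
elim: n x => [|n IH] x; first by rewrite !mulr0 !addr0.
by rewrite -natr1 mulrDr mulr1 addrA lift_tau IH addrA.
Qed.

Let liftDz x (n : int) : lift (x + tau * n%:~R) = lift x + tau * n%:~R.
Proof.
case: n => n; first exact: liftDn.
rewrite NegzE mulrNz mulrN.
by rewrite -[in RHS](subrK (tau * n.+1%:R) x) liftDn addrK.
Qed.

Lemma ebasic_lift x a : 0 <= a ->
  ebasic (lift (x + a) - lift x) = ebasic a :> fps K.
Proof.
move=> a0; have t0 := tau_gt0 R; have a1 : 0 <= a / tau by rewrite divr_ge0 // ltW.
rewrite /ebasic; congr (_ ^+ _); apply: truncn_def.
have /andP[] := truncn_itv a1; set n := Num.truncn _.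
rewrite ler_pdivlMr // ltr_pdivrMr // => na an.
rewrite ler_pdivlMr // ltr_pdivrMr // lerBrDl ltrBlDl.
rewrite ![_ * tau]mulrC -!liftDn lift_le ?lerD2l mulrC // mulrC.
by apply: lift_increasing; rewrite ltrD2l mulrC.
Qed.

Lemma arc_length_phi u v :
  arc_length (phi u) (phi v)
  = lift (repr u + arc_length u v) - lift (repr u).
Proof.
have h0 := arc_length_ge0 u v; have h1 := arc_length_lt u v.
rewrite -{1}(arc_lengthK u v) -{1}(cpt_repr u) !lift_cpt arc_length_cpt.
rewrite rem2pi_small //; first by rewrite subr_ge0 lift_le // lerDl.
by rewrite ltrBlDl -lift_tau; apply: lift_increasing; rewrite ltrD2l.
Qed.

Let arc_length_phi_trans u v w :
  ebasic (arc_length (phi u) (phi v) + arc_length (phi v) (phi w))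
  = ebasic (arc_length u v + arc_length v w) :> fps K.
Proof.
rewrite -[RHS](@ebasic_lift (repr u)); last first.
  by apply: addr_ge0; exact: arc_length_ge0.
congr (ebasic _); rewrite !arc_length_phi.
have /cptP/intrP[n E] : cpt (repr v) = cpt (repr u + arc_length u v).
  by rewrite arc_lengthK cpt_repr.
have -> : repr v = repr u + arc_length u v + tau * n%:~R.
  by rewrite -E; field; exact: tau_neq0.
set x := repr u; set a := arc_length u v; set b := arc_length v w.
have -> : x + a + tau * n%:~R + b = x + (a + b) + tau * n%:~R by ring.
by rewrite !liftDz; ring.
Qed.

Lemma Phi_phomE V W (f : phom V W) : Phi_phom f = f :> 'M[fps K]_(rk W, rk V).
Proof.
apply/matrixP => i j; rewrite !mxE /= ebasic_lift ?arc_length_ge0 //.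
by rewrite ebasic_small ?mulr1 // arc_length_lt.
Qed.

Lemma Phi_id V : Phi_phom (pid V) = pid (Phi_pobj V).
Proof. exact: (Phi_phomE (pid V)). Qed.

Lemma Phi_comp U V W (g : phom V W) (f : phom U V) :
  Phi_phom (pcomp g f) = pcomp (Phi_phom g) (Phi_phom f).
Proof.
rewrite [LHS]Phi_phomE; apply/matrixP => i j; rewrite [LHS]mxE [RHS]mxE.
by apply: eq_bigr => l _; rewrite !Phi_phomE arc_length_phi_trans.
Qed.

Lemma Phi_scale V W r (f : phom V W) : Phi_phom (r *: f) = r *: Phi_phom f.
Proof. by apply/matrixP => i j; rewrite !mxE mulrA. Qed.

Fact Phi_diff_sqr (X : fobj K R) :
  pcomp (Phi_phom (fdiff X)) (Phi_phom (fdiff X)) = fpsX *: pid (Phi_pobj X).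
Proof. by rewrite -Phi_comp diff_sqr Phi_scale Phi_id. Qed.

Definition Phi (X : fobj K R) : fobj K R := FObj (Phi_diff_sqr X).

Lemma Phi_fmor (X Y : fobj K R) (f : phom X Y) :
  fmor f -> @fmor K R (Phi X) (Phi Y) (Phi_phom f).
Proof. by rewrite /fmor /= -!Phi_comp => ->. Qed.

Fact lift_bounds x y : x <= y <= x + tau -> lift x <= lift y <= lift x + tau.
Proof. by move=> /andP[xy yx]; rewrite -lift_tau !lift_le. Qed.

Lemma Phi_E x y (h : x <= y <= x + tau) : Phi (E K h) = E K (lift_bounds h).
Proof.
apply: fobj_eq.
  by apply/funext => i /=; case: ifP => _; rewrite lift_cpt.
rewrite Phi_phomE; apply/matrixP => i j; rewrite !mxE; have /andP[xy yx] := h.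
case: ifP => // _; case: ifP => _.
  rewrite -[LHS](@ebasic_lift y) ?subr_ge0 // -lift_tau; congr (ebasic (lift _ - _)).
  ring.
rewrite -[LHS](@ebasic_lift x) ?subr_ge0 //; congr (ebasic (lift _ - _)); ring.
Qed.

End Phi.

Section Clusters.
Variables (K : fieldType) (R : realType).
Implicit Types X Y : fobj K R.

(** The indecomposable objects of C are the [E(x, y)] with [x < y < x + 2 pi]. *)
Definition indecomposable X : Prop :=
  exists x y (h : x <= y <= x + tau), x < y < x + tau /\ X = E K h.

Definition compatible X Y : Prop :=
  [\/ stable_hom0 X Y, stable_hom0 Y X | stable_iso X Y].

Definition off_diagonal : set (S1 R * S1 R) := [set p | p.1 <> p.2].

Definition same_class : rel off_diagonal :=
  fun p q => `[< stable_iso (E_pair K (\val p)) (E_pair K (\val q)) >].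

Fact same_class_refl : reflexive same_class.
Proof. by move=> p; apply/asboolP; exact: stable_iso_refl. Qed.

Fact same_class_sym : symmetric same_class.
Proof.
by move=> p q; apply/asboolP/asboolP; exact: stable_iso_sym.
Qed.

Fact same_class_trans : transitive same_class.
Proof.
move=> q p r /asboolP pq /asboolP qr; apply/asboolP.
exact: stable_iso_trans pq qr.
Qed.

Canonical same_class_equiv :=
  EquivRel same_class same_class_refl same_class_sym same_class_trans.

(** The space [M] of isomorphism classes of indecomposables of C, with the
  quotient topology from [{(x, y) | x <> y}]. *)
Definition classM : Type := quotient_topology {eq_quot same_class_equiv}.
HB.instance Definition _ := Topological.on classM.
HB.instance Definition _ := Quotient.on classM.

Definition class_of (p : off_diagonal) : classM := \pi_classM p.

Definition pairwise_compatible (S : set classM) : Prop :=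
  forall p q, S (class_of p) -> S (class_of q) ->
    compatible (E_pair K (\val p)) (E_pair K (\val q)).

Definition discrete_in_M (S : set classM) : Prop := S `<=` isolated S.

Definition cluster_classes (S : set classM) : Prop :=
  [/\ pairwise_compatible S,
      (forall S', pairwise_compatible S' -> S `<=` S' -> S' = S)
    & discrete_in_M S].

Definition classes_of (T : set (fobj K R)) : set classM :=
  class_of @` [set p | T (E_pair K (\val p))].

(** Clusters as sets of objects E(x, y), one in each class. *)
Definition is_cluster (T : set (fobj K R)) : Prop :=
  [/\ T `<=` indecomposable,
      (forall X Y, T X -> T Y -> stable_iso X Y -> X = Y)
    & cluster_classes (classes_of T)].

Definition same_up_to_iso (S T : set (fobj K R)) : Prop :=
  (forall X, S X -> exists2 Y, T Y & stable_iso X Y) /\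
  (forall Y, T Y -> exists2 X, S X & stable_iso X Y).

End Clusters.

(* Main.v *)
(* Write a chord of the circle by lifts [u < v < u + 2 pi] of its endpoints.  A
  morphism of F is stably null iff it has the form [b d + d b], so a computation
  with 2 x 2 matrices shows that E(u, v) and E(x, y) are compatible iff the
  chords do not cross.  A cluster is therefore an ideal triangulation of the
  disc: discreteness and maximality make it locally finite, hence both sides of
  every chord are triangles.  Starting from a given chord and adding apexes of
  triangles over and over, one obtains a family of vertices that is indexed and
  ordered independently of the cluster.  By local finiteness this family is dense
  in the circle and reaches every chord, so that matching the families of two
  clusters extends to an increasing bijection of the line. *)
From mathcomp Require Import all_boot all_order all_algebra generic_quotient.
From mathcomp Require Import all_classical all_reals all_analysis.
From mathcomp Require Import zify ring lra.
Require Import Defs.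
Import Order.TTheory GRing.Theory Num.Theory.
Import numFieldNormedType.Exports.

Set Implicit Arguments.
Unset Strict Implicit.
Unset Printing Implicit Defensive.

Local Open Scope classical_set_scope.
Local Open Scope ring_scope.

(** * The stable category *)

Section NullHomotopy.
Variables (K : fieldType) (R : realType).
Implicit Types X Y Z P : fobj K R.
Local Notation phom := (@phom K R).
Local Notation pinl := (@pinl K R).
Local Notation pinr := (@pinr K R).
Local Notation pfst := (@pfst K R).
Local Notation psnd := (@psnd K R).

(* The free object on [V]: [V + V] with differential [[0, t], [1, 0]]. *)
Definition free_diff (V : pobj R) : phom (psum V V) (psum V V) :=
  pcomp (pinr V V) (pfst V V) + fpsX *: pcomp (pinl V V) (psnd V V).

Lemma free_diff_inl V : pcomp (free_diff V) (pinl V V) = pinr V V :> phom _ _.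
Proof.
by rewrite pcompDl pcompZl -!pcompA pfst_inl psnd_inl pcomp0r scaler0 addr0 pcompf1.
Qed.

Lemma free_diff_inr V :
  pcomp (free_diff V) (pinr V V) = fpsX *: pinl V V :> phom _ _.
Proof.
by rewrite pcompDl pcompZl -!pcompA pfst_inr psnd_inr pcomp0r add0r pcompf1.
Qed.

Lemma fst_free_diff V :
  pcomp (pfst V V) (free_diff V) = fpsX *: psnd V V :> phom _ _.
Proof.
by rewrite pcompDr pcompZr !pcompA pfst_inl pfst_inr pcomp0l add0r pcomp1f.
Qed.

Lemma snd_free_diff V : pcomp (psnd V V) (free_diff V) = pfst V V :> phom _ _.
Proof.
rewrite pcompDr pcompZr !pcompA psnd_inl psnd_inr.
by rewrite pcomp0l scaler0 addr0 pcomp1f.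
Qed.

Fact free_diff_sqr (V : pobj R) :
  pcomp (free_diff V) (free_diff V) = fpsX *: pid (psum V V).
Proof.
rewrite {2}/free_diff pcompDr pcompZr !pcompA free_diff_inl free_diff_inr.
by rewrite pcompZl -scalerDr pinl_fst_inr_snd.
Qed.

Definition free_fobj (V : pobj R) : fobj K R := FObj (free_diff_sqr V).

(** The differential carries the first copy of [V] identically onto the second, so a morphism out of
    the free object is determined by its restriction to the first copy. That restriction lifts
    through the section of [p]. *)
Lemma free_fobj_projective V : fprojective (free_fobj V).
Proof.
move=> X Y Z i p [im pm [r [s [_ _ ps _]]]].
suff H (f : phom (psum V V) Z) : pcomp f (free_diff V) = pcomp (fdiff Z) f ->
    exists2 g : phom (psum V V) Y,
      pcomp g (free_diff V) = pcomp (fdiff Y) g & pcomp p g = f by exact: H.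
move=> fd; have [g0 psf] : exists g0, pcomp p g0 = pcomp f (pinl V V).
  by exists (pcomp s (pcomp f (pinl V V))); rewrite pcompA ps pcomp1f.
exists (pcomp g0 (pfst V V) + pcomp (fdiff Y) (pcomp g0 (psnd V V))).
  rewrite pcompDl pcompDr -!pcompA fst_free_diff snd_free_diff !pcompA.
  by rewrite diff_sqr pcompZr !pcompZl pcomp1f addrC.
rewrite pcompDr !pcompA psf pm -[X in pcomp X (psnd V V)]pcompA psf pcompA -fd.
rewrite -[X in pcomp X (psnd V V)]pcompA free_diff_inl -!pcompA -pcompDr.
by rewrite pinl_fst_inr_snd pcompf1.
Qed.

(** Dually, a morphism into the free object is determined by its component in the second copy, which
    the retraction of [i] extends. *)
Lemma free_fobj_injective V : finjective (free_fobj V).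
Proof.
move=> X Y Z i p [im pm [r [s [_ ri _ _]]]].
suff H (f : phom X (psum V V)) : pcomp f (fdiff X) = pcomp (free_diff V) f ->
    exists2 g : phom Y (psum V V),
      pcomp g (fdiff Y) = pcomp (free_diff V) g & pcomp g i = f by exact: H.
move=> fd; have [g0 psf] : exists g0, pcomp g0 i = pcomp (psnd V V) f.
  by exists (pcomp (pcomp (psnd V V) f) r); rewrite -pcompA ri pcompf1.
exists (pcomp (pinl V V) (pcomp g0 (fdiff Y)) + pcomp (pinr V V) g0).
  rewrite pcompDl pcompDr !pcompA free_diff_inl free_diff_inr -!pcompA.
  by rewrite diff_sqr pcompZl !pcompZr pcompf1 addrC.
rewrite pcompDl -!pcompA psf -im (pcompA g0) psf -pcompA fd.
rewrite (pcompA (psnd V V)) snd_free_diff !pcompA -pcompDl.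
by rewrite pinl_fst_inr_snd pcomp1f.
Qed.

(** If [f] factors through a projective [P], a section of the free cover of [P] yields a contracting
    homotopy of [P], to be composed with the two factors. Conversely [b d + d b] factors through the
    free object on [Y]. *)
Lemma stably_nullP X Y (f : phom X Y) : fmor f ->
  stably_null f <-> exists b : phom X Y, f = pcomp b (fdiff X) + pcomp (fdiff Y) b.
Proof.
move=> fm; split=> [[P [pP _ [g [h [gm hm ->]]]]]|[b fE]].
  (* The free cover [(a, b) |-> a + d b] has as kernel a copy of [P] embedded by [x |-> (- d x, x)],
     on which the differential becomes [- d]. *)
  pose i : phom P (psum P P) := pinr P P - pcomp (pinl P P) (fdiff P).
  pose p : phom (psum P P) P := pfst P P + pcomp (fdiff P) (psnd P P).
  have N2 : pcomp (- fdiff P) (- fdiff P) = fpsX *: pid P.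
    by rewrite pcompNl pcompNr opprK diff_sqr.
  pose N : fobj K R := FObj N2.
  have ex : @fexact K R N (free_fobj P) P i p.
    split.
    - rewrite /fmor /= /i pcompNr pcompDl pcompDr pcompNl pcompNr !pcompA.
      rewrite free_diff_inl free_diff_inr -!pcompA diff_sqr pcompZr pcompf1.
      by rewrite opprD opprK addrC.
    - rewrite /fmor /= /p pcompDl pcompDr -!pcompA fst_free_diff snd_free_diff.
      by rewrite pcompA diff_sqr pcompZl pcomp1f addrC.
    have pl : pcomp p (pinl P P) = pid P.
      by rewrite /p pcompDl -pcompA pfst_inl psnd_inl pcomp0r addr0.
    have pr : pcomp p (pinr P P) = fdiff P.
      by rewrite /p pcompDl -pcompA pfst_inr psnd_inr pcompf1 add0r.
    exists (psnd P P), (pinl P P); split => //.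
    - by rewrite /i pcompDr pcompNr pcompA pl pr pcomp1f subrr.
    - by rewrite /i pcompDr pcompNr pcompA psnd_inl psnd_inr pcomp0l oppr0 addr0.
    - rewrite /i /p pcompDl pcompDr pcompNl -!pcompA -pinl_fst_inr_snd.
      by rewrite addrC -addrA; congr (_ + _); rewrite addrC subrK.
  have [k km kE] := pP _ _ _ _ _ ex (pid P) (fmor_id P).
  have kd : pcomp (pfst P P) k = pcomp (pcomp (psnd P P) k) (fdiff P).
    by rewrite -snd_free_diff -!pcompA [in RHS]km.
  (* The second component [s] of the section [k] satisfies [s d + d s = 1] on [P]. *)
  exists (pcomp h (pcomp (pcomp (psnd P P) k) g)).
  rewrite -[in LHS](pcomp1f g) -kE /p pcompDl kd -(pcompA (fdiff P)).
  rewrite pcompDl pcompDr; congr (_ + _); first by rewrite -!pcompA gm.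
  by rewrite !pcompA hm.
exists (free_fobj Y); split.
- exact: free_fobj_projective.
- exact: free_fobj_injective.
(* The two factors are [(b d, b)] and [(1, d)]. *)
exists (pcomp (pinl Y Y) (pcomp b (fdiff X)) + pcomp (pinr Y Y) b).
exists (pfst Y Y + pcomp (fdiff Y) (psnd Y Y)); split.
- rewrite /fmor /= pcompDl pcompDr !pcompA free_diff_inl free_diff_inr -!pcompA.
  by rewrite diff_sqr pcompZl !pcompZr pcompf1 addrC.
- rewrite /fmor /= pcompDl pcompDr -!pcompA fst_free_diff snd_free_diff !pcompA.
  by rewrite diff_sqr pcompZl pcomp1f addrC.
- rewrite pcompDr !pcompDl -!pcompA !(pcompA (pfst _ _)) !(pcompA (psnd _ _)).
  rewrite pfst_inl pfst_inr psnd_inl psnd_inr !pcomp0l !pcomp0r !pcomp1f.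
  by rewrite fE addr0 add0r.
Qed.

End NullHomotopy.

(** * Matrix entries of composites with the differential of E(x, y) *)

Section Exponents.
Variables (K : fieldType) (R : realType).
Implicit Types x y : R.

Lemma arc_length_le x y : x <= y < x + tau -> arc_length (cpt x) (cpt y) = y - x.
Proof.
by case/andP=> xy yx; rewrite arc_length_cpt rem2pi_small ?subr_ge0 // ltrBlDl.
Qed.

Lemma arc_length_gt x y :
  y < x <= y + tau -> arc_length (cpt x) (cpt y) = y + tau - x.
Proof.
case/andP=> yx xy; rewrite arc_length_cpt -(rem2piD _ 1) mulr1.
by rewrite rem2pi_small; [ring|lra|lra].
Qed.

Lemma ebasic_wrap (a : R) : tau <= a < tau + tau -> ebasic a = fpsX :> fps K.
Proof.
case/andP=> ta at2; have t0 := tau_gt0 R.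
rewrite /ebasic (@truncn_def _ _ 1) ?expr1 //.
by rewrite ler_pdivlMr // ltr_pdivrMr //; apply/andP; split; lra.
Qed.

Lemma fpsX_mul0 (a : fps K) : (fpsX * a) 0%N = 0.
Proof. by rewrite [LHS]big_ord_recl big_ord0 addr0 mul0r. Qed.

(** Both arcs of the chord are shorter than 2 pi, so the differential has coordinates 0 and 1 and
    only exchanges the columns. The remaining [ebasic] is 1 or t, according to whether the two
    composed arcs go round the circle. *)
Lemma E_diffr x y (V : pobj R) (f : phom K (E_carrier x y) V) i : x < y < x + tau ->
  pcomp f (E_diff K x y) i 0
    = f i 1 * ebasic (y - x + arc_length (cpt y) (summand i)) /\
  pcomp f (E_diff K x y) i 1
    = f i 0 * ebasic (x + tau - y + arc_length (cpt x) (summand i)).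
Proof.
have o1 : lift ord0 ord0 = 1 :> 'I_2 by exact: val_inj.
case/andP=> xy yx; split; rewrite !mxE !big_ord_recl big_ord0 /= !mxE /=.
  rewrite mulr0 !mul0r !addr0 add0r ebasic_small; last by lra.
  by rewrite mulr1 arc_length_le ?o1 // ltW.
rewrite mulr0 !mul0r !addr0 ebasic_small; last by lra.
by rewrite mulr1 arc_length_gt // xy ltW.
Qed.

Lemma E_diffl x y (V : pobj R) (f : phom K V (E_carrier x y)) j : x < y < x + tau ->
  pcomp (E_diff K x y) f 0 j
    = f 1 j * ebasic (arc_length (summand j) (cpt y) + (x + tau - y)) /\
  pcomp (E_diff K x y) f 1 j
    = f 0 j * ebasic (arc_length (summand j) (cpt x) + (y - x)).
Proof.
have o1 : lift ord0 ord0 = 1 :> 'I_2 by exact: val_inj.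
case/andP=> xy yx; split; rewrite !mxE !big_ord_recl big_ord0 /= !mxE /=.
  rewrite !mul0r !addr0 add0r ebasic_small; last by lra.
  by rewrite mul1r arc_length_gt ?o1 // xy ltW.
rewrite !mul0r !addr0 ebasic_small; last by lra.
by rewrite mul1r arc_length_le // ltW.
Qed.

Lemma ord2_ind (P : 'I_2 -> Prop) : P 0 -> P 1 -> forall i, P i.
Proof.
move=> P0 P1 [[|[|//]] h].
- by have -> : Ordinal h = 0 by exact: val_inj.
- by have -> : Ordinal h = 1 by exact: val_inj.
Qed.

End Exponents.

(** * Stable morphisms between two objects E(x, y) *)

Section StableHom.
Variables (K : fieldType) (R : realType).
Implicit Types x y : R.

(* The second row of [f], placed in the first row, is a contracting homotopy. *)
Lemma stable_hom0_nested x0 x1 y0 y1 hx hy :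
  x0 <= y0 -> y0 < y1 -> y1 < x1 -> x1 < x0 + tau ->
  stable_hom0 (@E K R x0 x1 hx) (@E K R y0 y1 hy).
Proof.
move=> xy0 y01 yx1 x1t f fm; have t0 := tau_gt0 R.
have hX : x0 < x1 < x0 + tau by apply/andP; split; lra.
have hY : y0 < y1 < y0 + tau by apply/andP; split; lra.
have a00 : arc_length (cpt x0) (cpt y0) = y0 - x0.
  by rewrite arc_length_le //; apply/andP; split; lra.
have a01 : arc_length (cpt x0) (cpt y1) = y1 - x0.
  by rewrite arc_length_le //; apply/andP; split; lra.
have a10 : arc_length (cpt x1) (cpt y0) = y0 + tau - x1.
  by rewrite arc_length_gt //; apply/andP; split; lra.
have a11 : arc_length (cpt x1) (cpt y1) = y1 + tau - x1.
  by rewrite arc_length_gt //; apply/andP; split; lra.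
have fd i j : pcomp f (E_diff K x0 x1) i j = pcomp (E_diff K y0 y1) f i j.
  by congr (fun_of_matrix _ i j); exact: fm.
(* The second row of the commutation relation expresses the first row of [f] through the second. *)
have f00 : f 0 0 = f 1 1 * fpsX.
  have := fd 1 0; rewrite (E_diffr _ _ hX).1 (E_diffl _ _ hY).2 /= a00 a11.
  rewrite ebasic_wrap; last by lra.
  by rewrite ebasic_small ?mulr1 //; lra.
have f01 : f 0 1 = f 1 0.
  have := fd 1 1; rewrite (E_diffr _ _ hX).2 (E_diffl _ _ hY).2 /= a01 a10.
  rewrite ebasic_small; last by lra.
  by rewrite ebasic_small ?mulr1 //; lra.
pose b : phom K (E_carrier x0 x1) (E_carrier y0 y1) :=
  \matrix_(i, j) if i == 0 then f 1 j else 0.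
suff fE : f = pcomp b (E_diff K x0 x1) + pcomp (E_diff K y0 y1) b.
  by apply/stably_nullP => //; exists b.
apply/matrixP; apply: ord2_ind; apply: ord2_ind; rewrite [RHS]mxE /=.
- rewrite (E_diffr b 0 hX).1 (E_diffl b 0 hY).1 !mxE /= mul0r addr0 a10.
  by rewrite ebasic_wrap //; lra.
- rewrite (E_diffr b 0 hX).2 (E_diffl b 1 hY).1 !mxE /= mul0r addr0 a00.
  by rewrite ebasic_small ?mulr1 //; lra.
- rewrite (E_diffr b 1 hX).1 (E_diffl b 0 hY).2 !mxE /= mul0r add0r a00.
  by rewrite ebasic_small ?mulr1 //; lra.
- rewrite (E_diffr b 1 hX).2 (E_diffl b 1 hY).2 !mxE /= mul0r add0r a10.
  by rewrite ebasic_small ?mulr1 //; lra.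
Qed.

(** The identity matrix is a morphism with entry 1 at (0, 0). For every [b], both terms of
    [b d + d b] have an entry divisible by t there, as the composed arcs exceed 2 pi. *)
Lemma stable_hom_crossing x0 x1 y0 y1 hx hy :
  x0 < y0 -> y0 < x1 -> x1 < y1 -> y1 < x0 + tau ->
  ~ stable_hom0 (@E K R x0 x1 hx) (@E K R y0 y1 hy).
Proof.
move=> xy0 yx1 xy1 y1t H; have t0 := tau_gt0 R.
have hX : x0 < x1 < x0 + tau by apply/andP; split; lra.
have hY : y0 < y1 < y0 + tau by apply/andP; split; lra.
have a00 : arc_length (cpt x0) (cpt y0) = y0 - x0.
  by rewrite arc_length_le //; apply/andP; split; lra.
have a01 : arc_length (cpt x0) (cpt y1) = y1 - x0.
  by rewrite arc_length_le //; apply/andP; split; lra.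
have a10 : arc_length (cpt x1) (cpt y0) = y0 + tau - x1.
  by rewrite arc_length_gt //; apply/andP; split; lra.
have a11 : arc_length (cpt x1) (cpt y1) = y1 - x1.
  by rewrite arc_length_le //; apply/andP; split; lra.
pose f : phom K (E_carrier x0 x1) (E_carrier y0 y1) := 1%:M.
have fm : @fmor K R (E K hx) (E K hy) f.
  apply/matrixP; apply: ord2_ind; apply: ord2_ind.
  - by rewrite (E_diffr _ _ hX).1 (E_diffl _ _ hY).1 !mxE /= !mul0r.
  - rewrite (E_diffr _ _ hX).2 (E_diffl _ _ hY).1 !mxE /= a00 a11 !mul1r.
    by congr ebasic; lra.
  - rewrite (E_diffr _ _ hX).1 (E_diffl _ _ hY).2 !mxE /= a00 a11 !mul1r.
    by congr ebasic; lra.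
  - by rewrite (E_diffr _ _ hX).2 (E_diffl _ _ hY).2 !mxE /= !mul0r.
have /(stably_nullP fm)[b] := H f fm.
rewrite -[fdiff _]/(E_diff K x0 x1) -[fdiff (E K hy)]/(E_diff K y0 y1).
move=> /matrixP/(_ 0 0); rewrite [RHS]mxE (E_diffr _ _ hX).1 (E_diffl _ _ hY).1.
rewrite /= a01 a10 !ebasic_wrap; [|lra..].
rewrite mxE eqxx -mulrDl mulrC => /(congr1 (@^~ 0%N)).
by rewrite fpsX_mul0 => /eqP; rewrite [_ == _]oner_eq0.
Qed.

(** The matrix that exchanges the two summands is an isomorphism already in F. *)
Lemma E_rotate x y hxy hyx : x < y < x + tau ->
  stable_iso (@E K R x y hxy) (@E K R y (x + tau) hyx).
Proof.
move=> h; have /andP[xy yx] := h; have t0 := tau_gt0 R.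
have h' : y < x + tau < y + tau by apply/andP; split; lra.
have ct : cpt (x + tau) = cpt x.
  by apply/cptP; rewrite /cong2pi addrAC subrr add0r divff ?tau_neq0 // rpred1.
pose f : phom K (E_carrier x y) (E_carrier y (x + tau)) :=
  \matrix_(i, j) (i != j)%:R.
pose g : phom K (E_carrier y (x + tau)) (E_carrier x y) :=
  \matrix_(i, j) (i != j)%:R.
have fm : @fmor K R (E K hxy) (E K hyx) f.
  apply/matrixP; apply: ord2_ind; apply: ord2_ind.
  - rewrite (E_diffr f 0 h).1 (E_diffl f 0 h').1 !mxE /= ct !arc_lengthxx.
    by congr (_ * ebasic _); lra.
  - by rewrite (E_diffr f 0 h).2 (E_diffl f 1 h').1 !mxE /= !mul0r.
  - by rewrite (E_diffr f 1 h).1 (E_diffl f 0 h').2 !mxE /= !mul0r.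
  - rewrite (E_diffr f 1 h).2 (E_diffl f 1 h').2 !mxE /= ct !arc_lengthxx.
    by congr (_ * ebasic _); lra.
have gm : @fmor K R (E K hyx) (E K hxy) g.
  apply/matrixP; apply: ord2_ind; apply: ord2_ind.
  - rewrite (E_diffr g 0 h').1 (E_diffl g 0 h).1 !mxE /= ct !arc_lengthxx.
    by congr (_ * ebasic _); lra.
  - by rewrite (E_diffr g 0 h').2 (E_diffl g 1 h).1 !mxE /= !mul0r.
  - by rewrite (E_diffr g 1 h').1 (E_diffl g 0 h).2 !mxE /= !mul0r.
  - rewrite (E_diffr g 1 h').2 (E_diffl g 1 h).2 !mxE /= ct !arc_lengthxx.
    by congr (_ * ebasic _); lra.
have eb0 : ebasic (0 : R) = 1 :> fps K by rewrite ebasic_small.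
have gf : pcomp g f = pid (E_carrier x y).
  apply/matrixP; apply: ord2_ind; apply: ord2_ind;
    rewrite !mxE !big_ord_recl big_ord0 !mxE /= ?ct ?arc_lengthxx;
    by rewrite ?mul0r ?mulr0 ?mul1r ?addr0 ?add0r ?eb0 ?mul0r.
have fg : pcomp f g = pid (E_carrier y (x + tau)).
  apply/matrixP; apply: ord2_ind; apply: ord2_ind;
    rewrite !mxE !big_ord_recl big_ord0 !mxE /= ?ct ?arc_lengthxx;
    by rewrite ?mul0r ?mulr0 ?mul1r ?addr0 ?add0r ?eb0 ?mul0r.
exists f, g; split=> //.
  by rewrite gf subrr; exact: stably_null0.
by rewrite fg subrr; exact: stably_null0.
Qed.

End StableHom.

(** * Chords and compatibility *)

Section Chords.
Variables (K : fieldType) (R : realType).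
Implicit Types u v x y : R.

Lemma stably_nullN (X Y : fobj K R) (f : phom K X Y) :
  stably_null f -> stably_null (- f).
Proof.
move=> [P [pP iP [g [h [gm hm ->]]]]]; exists P; split=> //.
by exists g, (- h); split=> //; rewrite ?pcompNl // /fmor pcompNl hm pcompNr.
Qed.

(** For [k : X' -> Y'], the composite [q k f] is null by hypothesis, and [p (q k f) g] differs from
    [k] by terms containing [f g - 1] or [p q - 1]. *)
Lemma stable_hom0_iso (X X' Y Y' : fobj K R) :
  stable_iso X X' -> stable_iso Y Y' -> stable_hom0 X Y -> stable_hom0 X' Y'.
Proof.
move=> [f [g [fm gm _ fg]]] [p [q [pm qm _ pq]]] H k km.
have -> : k = pcomp p (pcomp (pcomp (pcomp q k) f) g)
    - (pcomp k (pcomp (pcomp f g - pid X') (pid X'))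
       + pcomp (pid Y') (pcomp (pcomp p q - pid Y') (pcomp k (pcomp f g)))).
  rewrite pcomp1f pcompf1 pcompDl pcompDr pcompNr pcompNl pcomp1f pcompf1.
  rewrite !pcompA; set a := pcomp (pcomp (pcomp (pcomp p q) k) f) g.
  by rewrite [_ + (a - _)]addrC addrA subrK opprB addrC subrK.
apply: stably_nullD.
  apply: stably_null_comp => //; apply: H.
  exact: fmor_comp (fmor_comp qm km) fm.
apply/stably_nullN/stably_nullD; apply: stably_null_comp => //.
- exact: fmor_id.
- exact: fmor_id.
- exact: fmor_comp km (fmor_comp fm gm).
Qed.

(** Going through [E_pair] dispenses with the proof of bounds that [E] requires, and makes the
    object depend only on the two points of the circle and their order. *)
Definition chord u v : fobj K R := E_pair K (cpt u, cpt v).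

Lemma cptDtau u : cpt (u + tau) = cpt u.
Proof.
by apply/cptP; rewrite /cong2pi addrAC subrr add0r divff ?tau_neq0 // rpred1.
Qed.

Lemma chordE u v h : v < u + tau -> chord u v = @E K R u v h.
Proof. exact: E_pairE. Qed.

Lemma chord_rotate u v : u < v < u + tau -> stable_iso (chord u v) (chord v (u + tau)).
Proof.
move=> /andP[uv vu]; have t0 := tau_gt0 R.
have h1 : u <= v <= u + tau by apply/andP; split; lra.
have h2 : v <= u + tau <= v + tau by apply/andP; split; lra.
rewrite (chordE h1) ?(chordE h2); [|lra..].
by apply: E_rotate; rewrite uv.
Qed.

Lemma chord_hom0_nested x0 x1 y0 y1 :
  x0 <= y0 -> y0 < y1 -> y1 < x1 -> x1 < x0 + tau ->
  stable_hom0 (chord x0 x1) (chord y0 y1).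
Proof.
move=> xy0 y01 yx1 x1t; have t0 := tau_gt0 R.
have h1 : x0 <= x1 <= x0 + tau by apply/andP; split; lra.
have h2 : y0 <= y1 <= y0 + tau by apply/andP; split; lra.
rewrite (chordE h1) ?(chordE h2); [|lra..].
exact: stable_hom0_nested.
Qed.

(** The second claim follows from the first after rotation: [(y0, y1)] crosses [(x1, x0 + tau)] in
    the same cyclic pattern. *)
Lemma chord_hom_crossing x0 x1 y0 y1 :
  x0 < y0 -> y0 < x1 -> x1 < y1 -> y1 < x0 + tau ->
  ~ stable_hom0 (chord x0 x1) (chord y0 y1) /\
  ~ stable_hom0 (chord y0 y1) (chord x0 x1).
Proof.
have H z0 z1 w0 w1 : z0 < w0 -> w0 < z1 -> z1 < w1 -> w1 < z0 + tau ->
    ~ stable_hom0 (chord z0 z1) (chord w0 w1).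
  move=> zw0 wz1 zw1 w1t; have t0 := tau_gt0 R.
  have h1 : z0 <= z1 <= z0 + tau by apply/andP; split; lra.
  have h2 : w0 <= w1 <= w0 + tau by apply/andP; split; lra.
  rewrite (chordE h1) ?(chordE h2); [|lra..].
  exact: stable_hom_crossing.
move=> xy0 yx1 xy1 y1t; have t0 := tau_gt0 R; split; first exact: H.
move=> yx; apply: (H y0 y1 x1 (x0 + tau)); [lra..|].
apply: stable_hom0_iso yx; first exact: stable_iso_refl.
by apply: chord_rotate; apply/andP; split; lra.
Qed.

Lemma compatible_sym (X Y : fobj K R) : compatible X Y -> compatible Y X.
Proof.
by case=> H; [apply: Or32|apply: Or31|apply/Or33/stable_iso_sym].
Qed.

Lemma compatible_iso (X X' Y Y' : fobj K R) :
  stable_iso X X' -> stable_iso Y Y' -> compatible X Y -> compatible X' Y'.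
Proof.
move=> XX YY [H|H|H].
- by apply: Or31; apply: stable_hom0_iso H.
- by apply: Or32; apply: stable_hom0_iso H.
- apply: Or33; apply: stable_iso_trans YY; apply: stable_iso_trans H.
  exact: stable_iso_sym.
Qed.

(* A short chord around the endpoint [x] is disjoint from [(u, v)] and crosses
   [(x, y)]. *)
Lemma chord_iso_endpoint u v x y :
  u < x < v -> v < u + tau -> x < y < x + tau ->
  ~ stable_iso (chord u v) (chord x y).
Proof.
move=> /andP[ux xv] vu /andP[xy yx] iso; have t0 := tau_gt0 R.
(* The bound [y - tau < a] ensures [y < a + tau], as a crossing requires. *)
have [a [ua ya ax]] : exists a, [/\ u <= a, y - tau < a & a < x].
  exists ((Num.max u (y - tau) + x) / 2).
  by split; case: (leP u (y - tau)) => ?; lra.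
have [b [bv by' xb]] : exists b, [/\ b < v, b < y & x < b].
  exists ((Num.min v y + x) / 2).
  by split; case: (leP v y) => ?; lra.
have [_] := @chord_hom_crossing a b x y ax xb by' ltac:(lra).
apply; apply: stable_hom0_iso iso (stable_iso_refl _) _.
by apply: chord_hom0_nested => //; lra.
Qed.

(** An endpoint of the second chord lies in neither of the open arcs cut off by the first;
    [(v - tau, u)] is the lift of the other arc. *)
Lemma chord_iso_eq u v x y : u < v < u + tau -> x < y < x + tau ->
  v - tau < x < v -> stable_iso (chord u v) (chord x y) -> x = u.
Proof.
move=> /andP[uv vu] xy /andP[vx xv] iso.
have [ux|xu|//] := ltgtP u x; exfalso.
  by apply: (chord_iso_endpoint _ vu xy iso); rewrite ux.
apply: (@chord_iso_endpoint (v - tau) u x y _ _ xy); [by rewrite vx|lra|].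
apply: stable_iso_trans iso.
have -> : chord u v = chord u (v - tau + tau) by rewrite subrK.
by apply: chord_rotate; apply/andP; split; lra.
Qed.

Lemma crossing_incompatible x0 x1 y0 y1 :
  x0 < y0 -> y0 < x1 -> x1 < y1 -> y1 < x0 + tau ->
  ~ compatible (chord x0 x1) (chord y0 y1).
Proof.
move=> xy0 yx1 xy1 y1t; have [H1 H2] := chord_hom_crossing xy0 yx1 xy1 y1t.
case=> // iso; apply: (chord_iso_endpoint _ _ _ iso); rewrite ?xy0 //; first by lra.
by apply/andP; split; lra.
Qed.

(** Morphisms from the outer to the inner chord vanish when the right ends differ. If the right ends
    agree, rotation turns the left ends into right ends and exchanges outer and inner. *)
Lemma nested_compatible x0 x1 y0 y1 :
  x0 <= y0 -> y0 < y1 -> y1 <= x1 -> x1 < x0 + tau ->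
  compatible (chord x0 x1) (chord y0 y1).
Proof.
move=> xy0 y01 yx1 x1t; have t0 := tau_gt0 R.
have [yx|xy|<-] := ltgtP y1 x1; [|lra|].
  by apply: Or31; exact: chord_hom0_nested.
have [yx|xy|<-] := ltgtP y0 x0; [lra| |exact/Or33/stable_iso_refl].
apply: Or32.
apply: (@stable_hom0_iso (chord y1 (y0 + tau)) _ (chord y1 (x0 + tau))).
- by apply/stable_iso_sym/chord_rotate/andP; split; lra.
- by apply/stable_iso_sym/chord_rotate/andP; split; lra.
- by apply: chord_hom0_nested; lra.
Qed.

End Chords.

(** * Tessellations of the line *)

Section Tessellation.
Variables (R : realType) (T : R).
Implicit Types (u v x y p q : R) (L : R -> R -> Prop).

(* [L u v]: the points [u < v < u + T] of the line, of period [T], are lifts of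
  the endpoints of a chord of the tessellation. *)
Record tessellation L : Prop := Tessellation {
  tess_bounds : forall u v, L u v -> u < v < u + T ;
  tess_rotate : forall u v, L u v <-> L v (u + T) ;
  tess_noncrossing : forall u v x y, L u v -> L x y ->
    u < x -> x < v -> v < y -> y < u + T -> False ;
  tess_maximal : forall u v, u < v < u + T ->
    (forall x y, L x y -> u < x -> x < v -> v < y -> y < u + T -> False) ->
    L u v ;
  tess_discrete : forall u v, L u v -> exists2 e, 0 < e & forall x y,
    L x y -> `|x - u| < e -> `|y - v| < e -> x = u /\ y = v }.

Variables (L : R -> R -> Prop) (tL : tessellation L).

(** If [(p, q)] is not a chord, maximality provides a chord that crosses it, and this one would also
    cross every chord close to [(p, q)]. Thus chords do not accumulate at any nondegenerate pair. *)
Lemma tess_locally_finite p q : p < q < p + T -> exists2 e, 0 < e &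
  forall x y, L x y -> `|x - p| < e -> `|y - q| < e -> x = p /\ y = q.
Proof.
move=> pq; have [/(tess_discrete tL)//|nL] := pselect (L p q).
have [x [y [Lxy px xq qy yp]]] : exists x y,
    [/\ L x y, p < x, x < q, q < y & y < p + T].
  apply: contrapT => H; apply: nL; apply: (tess_maximal tL pq) => x y Lxy.
  by move=> px xq qy yp; apply: H; exists x, y.
exists (Num.min (Num.min (x - p) (q - x)) (Num.min (y - q) (p + T - y))).
  by rewrite !lt_min !subr_gt0 px xq qy yp.
move=> p' q' L'; rewrite !lt_min !ltr_norml.
move=> /andP[/andP[/andP[_ ?] _] /andP[_ /andP[? _]]].
move=> /andP[/andP[_ /andP[? _]] /andP[/andP[_ ?] _]].
by exfalso; apply: (tess_noncrossing tL L' Lxy); lra.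
Qed.

Lemma tess_unrotate u v : L u v -> L (v - T) u.
Proof. by move=> Luv; apply/(tess_rotate tL); rewrite subrK. Qed.

Lemma tess_shift u v : L u v <-> L (u + T) (v + T).
Proof. by rewrite (tess_rotate tL) (tess_rotate tL). Qed.

Section Apex.
Variables (u v : R) (Luv : L u v).

Let covers w p q :=
  [/\ L p q, u <= p < w, w < q <= v & ~ (p = u /\ q = v)].

(** The infimum of the left ends and the supremum of the right ends are attained by one and the same
    chord, by local finiteness at that pair. *)
Let outermost w : (exists p q, covers w p q) -> exists p q, covers w p q /\
  forall p' q', covers w p' q' -> p <= p' /\ q' <= q.
Proof.
move=> [p0 [q0 c0]]; have /andP[uv vT] := tess_bounds tL Luv.
pose A := [set p | exists q, covers w p q].
pose B := [set q | exists p, covers w p q].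
have hA : has_inf A.
  split; first by exists p0, q0.
  by exists u => p [q [_ /andP[]]].
have hB : has_sup B.
  split; first by exists q0, p0.
  by exists v => q [p [_ _ /andP[]]].
have ub p q : covers w p q -> inf A <= p /\ q <= sup B.
  move=> c; split; first by apply: inf_lbound; [exact: hA.2|exists q].
  by apply: ub_le_sup; [exact: hB.2|exists p].
have uA : u <= inf A.
  by apply: lb_le_inf; [exact: hA.1|move=> p [q [_ /andP[]]]].
have vB : sup B <= v.
  by apply: ge_sup; [exact: hB.1|move=> q [p [_ _ /andP[]]]].
have [_ /andP[_ p0w] /andP[wq0 _] _] := c0; have [l0 r0] := ub _ _ c0.
have [|e e0 fin] := @tess_locally_finite (inf A) (sup B).
  by apply/andP; split; lra.
have [p1 [q1 c1] h1] := inf_adherent e0 hA.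
have [q2 [p2 c2] h2] := sup_adherent e0 hB.
(* Both chords cover [w] and do not cross, so they are nested, and the larger one is close to the
   extremal pair at both ends. *)
have [p [q [c pe qe]]] : exists p q,
    [/\ covers w p q, p < inf A + e & sup B - e < q].
  have [L1 /andP[? ?] /andP[? ?] _] := c1; have [L2 /andP[? ?] /andP[? ?] _] := c2.
  have [q12|q12] := leP q2 q1; first by exists p1, q1; split=> //; lra.
  have [p12|p12] := leP p2 p1; first by exists p2, q2; split=> //; lra.
  by exfalso; apply: (tess_noncrossing tL L1 L2); lra.
have [Lpq _ _ _] := c; have [l r] := ub _ _ c.
have [||pE qE] := fin p q Lpq; rewrite ?ltr_norml; [apply/andP; split; lra..|].
by exists p, q; split=> // p' q' /ub; rewrite pE qE.
Qed.

(* The apex is an endpoint of the outermost chord below [(u, v)] that covers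
  a point [w], and [w] itself when there is no such chord. *)
Lemma tess_apex : exists m, [/\ u < m < v, L u m & L m v].
Proof.
have /andP[uv vT] := tess_bounds tL Luv.
have below x y : L x y -> u < x -> x < v -> y < u + T -> y <= v.
  move=> Lxy ux xv yu; rewrite leNgt; apply/negP => vy.
  exact: (tess_noncrossing tL Luv Lxy).
have above x y : L x y -> u < x -> x < v -> v < y -> u + T <= y.
  move=> Lxy ux xv vy; rewrite leNgt; apply/negP => yu.
  exact: (tess_noncrossing tL Luv Lxy).
have [w uw wv] : exists2 w, u < w & w < v by exists ((u + v) / 2); lra.
have [/outermost[p [q [c out]]]|none] := pselect (exists p q, covers w p q).
  have [Lpq /andP[up pw] /andP[wq qv] ne] := c.
  have [up'|pE] := ltP u p; last first.
    (* Here the apex is [q]: a chord crossing [(q, v)] has a lift with right end beyond [q], which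
       either covers [w], against the choice of [q], or crosses [(u, q)]. *)
    have {up pE} pE : p = u by lra.
    have {}qv : q < v by rewrite lt_neqAle qv andbT; apply/eqP => qE; apply: ne.
    rewrite pE in Lpq; exists q; split=> //; first by apply/andP; split; lra.
    apply: (tess_maximal tL) => [|x y Lxy qx xv vy yq].
      by apply/andP; split; lra.
    have uy := above x y Lxy ltac:(lra) xv vy.
    have L' := tess_unrotate Lxy.
    have [yw|wy] := ltP (y - T) w.
      have [|? ?] := out (y - T) x; [|lra].
      by split=> //; [apply/andP; split; lra..|lra].
    by apply: (tess_noncrossing tL Lpq L'); lra.
  have [qv'|qE] := ltP q v; last first.
    have {qv qE} qE : q = v by lra.
    rewrite qE in Lpq; exists p; split=> //; first by apply/andP; split; lra.
    apply: (tess_maximal tL) => [|x y Lxy ux xp py yu].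
      by apply/andP; split; lra.
    have yv := below x y Lxy ux ltac:(lra) yu.
    have [wy|yw] := ltP w y.
      have [|? ?] := out x y; [|lra].
      by split=> //; [apply/andP; split; lra..|lra].
    by apply: (tess_noncrossing tL Lxy Lpq); lra.
  (* If both ends differ from [u] and [v], then [(u, q)] is a chord covering [w] and larger than the
     outermost one. *)
  have Luq : L u q.
    apply: (tess_maximal tL) => [|x y Lxy ux xq qy yu].
      by apply/andP; split; lra.
    have yv := below x y Lxy ux ltac:(lra) yu.
    have [xw|wx] := ltP x w.
      have [|? ?] := out x y; [|lra].
      by split=> //; [apply/andP; split; lra..|lra].
    by apply: (tess_noncrossing tL Lpq Lxy); lra.
  have [|? ?] := out u q; [|lra].
  by split=> //; [apply/andP; split; lra..|lra].
exists w; split; first by rewrite uw.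
  apply: (tess_maximal tL) => [|x y Lxy ux xw wy yu].
    by apply/andP; split; lra.
  have yv := below x y Lxy ux ltac:(lra) yu.
  by apply: none; exists x, y; split=> //; [apply/andP; split; lra..|lra].
apply: (tess_maximal tL) => [|x y Lxy wx xv vy yw].
  by apply/andP; split; lra.
have uy := above x y Lxy ltac:(lra) xv vy.
apply: none; exists (y - T), x; split; first exact: tess_unrotate.
- by apply/andP; split; lra.
- by apply/andP; split; lra.
- by lra.
Qed.

Lemma tess_apex_unique m m' : u < m < v -> u < m' < v ->
  L u m -> L m v -> L u m' -> L m' v -> m = m'.
Proof.
move=> /andP[? ?] /andP[? ?] um mv um' mv'; have /andP[? ?] := tess_bounds tL Luv.
have [mm|mm|//] := ltgtP m m'; exfalso.
  by apply: (tess_noncrossing tL um' mv); lra.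
by apply: (tess_noncrossing tL um mv'); lra.
Qed.

End Apex.

End Tessellation.

(** * Vertices obtained by iterated apexes *)

Section Vertices.
Variables (R : realType) (T : R) (L : R -> R -> Prop) (tL : tessellation T L).
Variables (x0 x1 : R) (L01 : L x0 x1).
Implicit Types (u v : R) (n m : nat) (j k : int).

Definition apex u v : R := xget 0 [set m | [/\ u < m < v, L u m & L m v]].

Lemma apexP u v : L u v -> [/\ u < apex u v < v, L u (apex u v) & L (apex u v) v].
Proof.
move=> Luv; have [m mP] := tess_apex tL Luv.
by apply: (@xgetPex _ 0 [set m | [/\ u < m < v, L u m & L m v]]); exists m.
Qed.

Lemma apexDT u v : L u v -> apex (u + T) (v + T) = apex u v + T.
Proof.
move=> Luv; have /(tess_shift tL) LT := Luv.
have [h1 l1 r1] := apexP LT; have [h2 l2 r2] := apexP Luv.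
have h3 : u + T < apex u v + T < v + T by rewrite !ltrD2r.
by apply: (tess_apex_unique tL LT h1 h3 l1 r1); apply: (tess_shift tL _ _).1.
Qed.

(* [vertex n] enumerates increasingly the points obtained from the lifts of
  [x0] and [x1] by adding apexes [n] times; all indices are doubled at each step. *)
Fixpoint vertex n k : R :=
  let j := (k %/ 2)%Z in
  if n is m.+1 then
    if k == j * 2 then vertex m j else apex (vertex m j) (vertex m (j + 1))
  else (if k == j * 2 then x0 else x1) + T * j%:~R.

Lemma int_parity k : exists j, k = j * 2 \/ k = j * 2 + 1.
Proof. by exists (k %/ 2)%Z; lia. Qed.

Lemma vertex0_even j : vertex 0 (j * 2) = x0 + T * j%:~R.
Proof. by rewrite /= mulzK // eqxx. Qed.

Let odd_div j : ((j * 2 + 1) %/ 2)%Z = j.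
Proof. by lia. Qed.

Let odd_neq j : (j * 2 + 1 == j * 2) = false.
Proof. by lia. Qed.

Lemma vertex0_odd j : vertex 0 (j * 2 + 1) = x1 + T * j%:~R.
Proof. by rewrite /= odd_div odd_neq. Qed.

Lemma vertexS_even n j : vertex n.+1 (j * 2) = vertex n j.
Proof. by rewrite /= mulzK // eqxx. Qed.

Lemma vertexS_odd n j :
  vertex n.+1 (j * 2 + 1) = apex (vertex n j) (vertex n (j + 1)).
Proof. by rewrite /= odd_div odd_neq. Qed.

Lemma vertex0DT k : vertex 0 (k + 2) = vertex 0 k + T.
Proof.
have [j [->|->]] := int_parity k.
  by rewrite -[j * 2 + 2]/(j * 2 + 1 * 2) -mulrDl !vertex0_even intrD; ring.
rewrite [j * 2 + 1 + 2](_ : _ = (j + 1) * 2 + 1); last by ring.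
by rewrite !vertex0_odd intrD; ring.
Qed.

Lemma tess_shiftz u v j : L u v -> L (u + T * j%:~R) (v + T * j%:~R).
Proof.
move=> Luv; have H (i : nat) w z : L w z -> L (w + T * i%:R) (z + T * i%:R).
  elim: i w z => [|i IH] w z Lwz; first by rewrite !mulr0 !addr0.
  by rewrite -natr1 !mulrDr !mulr1 !addrA; apply/(tess_shift tL _ _).1/IH.
case: j => i; first exact: H.
rewrite NegzE mulrNz !mulrN.
have back (k : nat) w z : L w z -> L (w - T * k%:R) (z - T * k%:R).
  elim: k w z => [|k IH] w z Lwz; first by rewrite !mulr0 !subr0.
  rewrite -natr1 mulrDr mulr1 !opprD !addrA.
  by apply: (tess_shift tL _ _).2; rewrite !subrK; exact: IH.
exact: back.
Qed.

(** Stage 0 consists of the lifts of one chord, and each later stage replaces a chord by the two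
    other sides of its triangle. Hence [apex] never takes its default value here. *)
Lemma vertex_chord n k : L (vertex n k) (vertex n (k + 1)).
Proof.
elim: n k => [|n IH] k; have [j [->|->]] := int_parity k.
- by rewrite vertex0_even vertex0_odd; exact: tess_shiftz.
- rewrite [j * 2 + 1 + 1](_ : _ = (j + 1) * 2); last by ring.
  rewrite vertex0_even vertex0_odd intrD mulrDr mulr1 addrA.
  by apply: (tess_rotate tL _ _).1; apply: tess_shiftz.
- by rewrite vertexS_even vertexS_odd; have [] := apexP (IH j).
- rewrite [j * 2 + 1 + 1](_ : _ = (j + 1) * 2); last by ring.
  by rewrite vertexS_even vertexS_odd; have [] := apexP (IH j).
Qed.

(** A period contains two vertices at stage 0, and their number doubles at each stage. *)
Lemma vertexDT n k : vertex n (k + 2 ^+ n.+1) = vertex n k + T.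
Proof.
elim: n k => [|n IH] k; first by rewrite expr1 vertex0DT.
have [j [->|->]] := int_parity k.
  by rewrite exprSr -mulrDl !vertexS_even.
rewrite [_ + _ ^+ _](_ : _ = (j + 2 ^+ n.+1) * 2 + 1); last by rewrite exprSr; ring.
by rewrite !vertexS_odd addrAC !IH apexDT //; exact: vertex_chord.
Qed.

Lemma vertex_lt n k : vertex n k < vertex n (k + 1).
Proof. by have /andP[] := tess_bounds tL (vertex_chord n k). Qed.

Lemma ltr_vertex n : {mono vertex n : j k / j < k}.
Proof.
have H (i : nat) j : vertex n j < vertex n (j + 1 + i%:Z).
  elim: i => [|i IH]; first by rewrite addr0 vertex_lt.
  by apply: lt_trans IH _; rewrite -addn1 PoszD addrA vertex_lt.
have H' (j k : int) : j < k -> vertex n j < vertex n k.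
  by move=> jk; have -> : k = j + 1 + (absz (k - (j + 1))%R)%:Z by lia.
by apply/leW_mono/le_mono => j k; exact: H'.
Qed.

Lemma ler_vertex n : {mono vertex n : j k / j <= k}.
Proof. by move=> j k; rewrite !leNgt ltr_vertex. Qed.

Lemma vertex_refine n m k : vertex (m + n) (k * 2 ^+ m) = vertex n k.
Proof.
elim: m => [|m IH]; first by rewrite expr0 mulr1.
by rewrite addSn exprSr mulrA vertexS_even.
Qed.

Lemma vertex_stage n l j : (n <= l)%N -> exists j', vertex n j = vertex l j'.
Proof.
by move=> nl; exists (j * 2 ^+ (l - n)); rewrite -(vertex_refine n (l - n) j) subnK.
Qed.

(** The right-hand side does not depend on [L]; this is what allows the vertices of two
    tessellations to be matched. *)
Lemma ler_vertex2 n m j k :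
  (vertex n j <= vertex m k) = (j * 2 ^+ m <= k * 2 ^+ n).
Proof.
rewrite -(vertex_refine n m) -(vertex_refine m n) addnC.
by rewrite ler_vertex.
Qed.

Lemma vertex_floor n (a : R) : exists k, vertex n k <= a < vertex n (k + 1).
Proof.
have T0 : 0 < T by have /andP[? ?] := tess_bounds tL L01; lra.
elim: n => [|n [k /andP[ka ak]]].
  pose j := Num.floor ((a - x0) / T).
  have h1 : x0 + T * j%:~R <= a.
    by rewrite addrC -lerBrDr mulrC -ler_pdivlMr // floor_le.
  have h2 : a < x0 + T * (j + 1)%:~R.
    by rewrite addrC -ltrBlDr mulrC -ltr_pdivrMr // floorD1_gt.
  have [h3|h3] := leP (x1 + T * j%:~R) a.
    exists (j * 2 + 1); rewrite [j * 2 + 1 + 1](_ : _ = (j + 1) * 2); last by ring.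
    by rewrite vertex0_odd vertex0_even h3.
  by exists (j * 2); rewrite vertex0_odd vertex0_even h1.
have [h|h] := leP (vertex n.+1 (k * 2 + 1)) a.
  exists (k * 2 + 1); rewrite [k * 2 + 1 + 1](_ : _ = (k + 1) * 2); last by ring.
  by rewrite vertexS_even h.
by exists (k * 2); rewrite vertexS_even ka.
Qed.

(** Otherwise a chord of every stage spans the gap between [a] and [b]. By local finiteness these
    chords are eventually constant, but each new stage adds an apex strictly inside. *)
Lemma vertex_dense (a b : R) : a < b -> exists n k, a < vertex n k < b.
Proof.
move=> ab; apply: contrapT => none.
have out n k : a < vertex n k -> b <= vertex n k.
  move=> ak; rewrite leNgt; apply/negP => kb; apply: none.
  by exists n, k; rewrite ak.
have gap n : exists k, vertex n k <= a /\ b <= vertex n (k + 1).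
  by have [k /andP[ka /out kb]] := vertex_floor n a; exists k.
pose A := [set p | exists n k, p = vertex n k /\ p <= a].
pose B := [set q | exists n k, q = vertex n k /\ b <= q].
have [k0 [k0a k0b]] := gap 0.
have hA : has_sup A.
  split; first by exists (vertex 0 k0); exists 0%N, k0.
  by exists a => p [n [k []]].
have hB : has_inf B.
  split; first by exists (vertex 0 (k0 + 1)); exists 0%N, (k0 + 1).
  by exists b => p [n [k []]].
have Aub n k : vertex n k <= a -> vertex n k <= sup A.
  by move=> ka; apply: ub_le_sup; [exact: hA.2|exists n, k].
have Blb n k : b <= vertex n k -> inf B <= vertex n k.
  by move=> ka; apply: inf_lbound; [exact: hB.2|exists n, k].
have Aa : sup A <= a by apply: ge_sup; [exact: hA.1|move=> p [n [k []]]].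
have bB : b <= inf B by apply: lb_le_inf; [exact: hB.1|move=> p [n [k []]]].
have /andP[_ hT] := tess_bounds tL (vertex_chord 0 k0).
have [|e e0 fin] := @tess_locally_finite _ _ _ tL (sup A) (inf B).
  by have := Aub _ _ k0a; have := Blb _ _ k0b; move=> ? ?; apply/andP; split; lra.
have [_ [n [i [-> ia]]] h1] := sup_adherent e0 hA.
have [_ [m [j [-> jb]]] h2] := inf_adherent e0 hB.
(* The vertices [i] and [j] near the two limits recur at every stage [l >= n + m], and the spanning
   chord of that stage is at least as tight. *)
have tail l k : (n + m <= l)%N -> vertex l k <= a -> b <= vertex l (k + 1) ->
    vertex l k = sup A /\ vertex l (k + 1) = inf B.
  move=> nml ka kb; apply: fin; first exact: vertex_chord.
    have hi : vertex n i <= vertex l k.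
      have [i' iE] := vertex_stage i (leq_trans (leq_addr m n) nml).
      rewrite iE ler_vertex -ltzD1 -(ltr_vertex l) -iE.
      exact: le_lt_trans ia (lt_le_trans ab kb).
    by have := Aub _ _ ka; rewrite ltr_norml => ?; apply/andP; split; lra.
  have hj : vertex l (k + 1) <= vertex m j.
    have [j' jE] := vertex_stage j (leq_trans (leq_addl n m) nml).
    rewrite jE ler_vertex lezD1 -(ltr_vertex l) -jE.
    exact: le_lt_trans ka (lt_le_trans ab jb).
  by have := Blb _ _ kb; rewrite ltr_norml => ?; apply/andP; split; lra.
have [k [ka kb]] := gap (n + m)%N.
have [kA kB] := tail _ _ (leqnn _) ka kb.
have [k' [k'a k'b]] := gap (n + m).+1.
have [k'A k'B] := tail _ _ (leqnSn _) k'a k'b.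
(* The same two points are consecutive at successive stages, although the apex of index [k * 2 + 1]
   separates them at the later one. *)
have kE : vertex (n + m).+1 (k * 2) = vertex (n + m).+1 k'.
  by rewrite vertexS_even kA k'A.
have kE' : vertex (n + m).+1 ((k + 1) * 2) = vertex (n + m).+1 (k' + 1).
  by rewrite vertexS_even kB k'B.
have mid1 : k * 2 < k * 2 + 1 by rewrite ltrDl.
have mid2 : k * 2 + 1 < (k + 1) * 2 by rewrite mulrDl ltrD2l.
have : k' < k * 2 + 1 by rewrite -(ltr_vertex (n + m).+1) -kE ltr_vertex.
have : k * 2 + 1 < k' + 1 by rewrite -(ltr_vertex (n + m).+1) -kE' ltr_vertex.
by rewrite ltzD1 => h3 h4; have := le_lt_trans h3 h4; rewrite ltxx.
Qed.

(* Otherwise the chord would lie below one of the [n]-th stage chords for every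
  [n], contradicting density. *)
Lemma vertex_exhaust_below n k u v : L u v -> vertex n k <= u -> v <= vertex n (k + 1) ->
  exists m j, u = vertex m j /\ v = vertex m (j + 1).
Proof.
move=> Luv ku vk; apply: contrapT => none.
have /andP[uv _] := tess_bounds tL Luv.
have below m : exists j, vertex (m + n) j <= u /\ v <= vertex (m + n) (j + 1).
  elim: m => [|m [j [ju vj]]]; first by exists k.
  pose a := vertex (m + n).+1 (j * 2 + 1).
  have [aE1 aE2] : (vertex (m + n).+1 (j * 2) = vertex (m + n) j) /\
      (vertex (m + n).+1 (j * 2 + 1 + 1) = vertex (m + n) (j + 1)).
    rewrite vertexS_even [j * 2 + 1 + 1](_ : _ = (j + 1) * 2); last by ring.
    by rewrite vertexS_even.
  have La := vertex_chord (m + n).+1 (j * 2); have Lb := vertex_chord (m + n).+1 (j * 2 + 1).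
  have /andP[_ hT] := tess_bounds tL (vertex_chord (m + n) j).
  rewrite aE1 in La; rewrite aE2 in Lb; rewrite -/a in La Lb.
  have [ua|au] := ltP u a; last by exists (j * 2 + 1); rewrite addSn aE2.
  have [av|va] := ltP a v; last by exists (j * 2); rewrite addSn aE1.
  (* Now [u < a < v]: unless [(u, v)] is the spanning chord itself, it crosses a side of the
     triangle with apex [a]. *)
  exfalso; have /andP[? ?] := tess_bounds tL La; have /andP[? ?] := tess_bounds tL Lb.
  have [ju'|uj] := ltP (vertex (m + n) j) u.
    by apply: (tess_noncrossing tL La Luv); lra.
  have [vj'|jv] := ltP v (vertex (m + n) (j + 1)).
    by apply: (tess_noncrossing tL Luv Lb); lra.
  by apply: none; exists (m + n)%N, j; split; apply/eqP; rewrite eq_le ?ju ?vj ?uj ?jv.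
(* A vertex of stage [m] strictly inside [(u, v)] would lie strictly between two consecutive
   vertices of the later stage [m + n]. *)
have [m [i /andP[ui iv]]] := vertex_dense uv.
have [j [ju vj]] := below m.
have h1 : vertex (n + m) (i * 2 ^+ n) < vertex (m + n) (j + 1).
  by rewrite vertex_refine; lra.
have h2 : vertex (m + n) j < vertex (n + m) (i * 2 ^+ n).
  by rewrite vertex_refine; lra.
by move: h1 h2; rewrite [in vertex (n + m)]addnC !ltr_vertex; lia.
Qed.

(** A chord crosses no chord of stage 0, so one of its lifts [(u, v)] and [(v, u + T)] lies below a
    chord of that stage. *)
Lemma vertex_exhaust u v : L u v -> exists n k,
  (u = vertex n k /\ v = vertex n (k + 1)) \/
  (v = vertex n k /\ u + T = vertex n (k + 1)).
Proof.
move=> Luv; have /andP[uv vu] := tess_bounds tL Luv.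
have [k /andP[ku uk]] := vertex_floor 0 u.
have k2 : vertex 0 (k + 1 + 1) = vertex 0 k + T by rewrite -vertex0DT -addrA.
have k3 : vertex 0 (k + 1 + 1 + 1) = vertex 0 (k + 1) + T by rewrite -vertex0DT -addrA.
have [vk|kv] := leP v (vertex 0 (k + 1)).
  have [m [j h]] := vertex_exhaust_below Luv ku vk.
  by exists m, j; left.
suff [i [iv vi]] : exists i, vertex 0 i <= v /\ u + T <= vertex 0 (i + 1).
  have [|m [j h]] := vertex_exhaust_below _ iv vi; first exact: (tess_rotate tL _ _).1.
  by exists m, j; right.
(* If [u] is strictly inside its interval, noncrossing pushes [v] to the next period; if [u] is a
   vertex, [(v, u + T)] fits in the following interval. *)
have [ku'|uk'] := ltP (vertex 0 k) u.
  exists (k + 1 + 1); split; last by lra.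
  rewrite leNgt; apply/negP => vk.
  by apply: (tess_noncrossing tL (vertex_chord 0 k) Luv); lra.
by exists (k + 1); split; lra.
Qed.

End Vertices.

(** * Extension to a homeomorphism *)

Section DenseExtension.
Variables (R : realType) (I : Type).
Implicit Types (D : I -> R) (i j : I).

Definition dense_family D := forall a b : R, a < b -> exists i, a < D i < b.

Definition same_order D D' := forall i j, (D i <= D j) = (D' i <= D' j).

Definition extension D D' (x : R) : R :=
  sup [set y | exists2 i, y = D' i & D i <= x].

Lemma same_order_sym D D' : same_order D D' -> same_order D' D.
Proof. by move=> o i j; rewrite o. Qed.

Section Extension.
Variables (D D' : I -> R) (dD : dense_family D) (oD : same_order D D').
Local Notation F := (extension D D').

Lemma same_order_lt i j : (D i < D j) = (D' i < D' j).
Proof. by rewrite !ltNge oD. Qed.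

Let has_supF x : has_sup [set y | exists2 i, y = D' i & D i <= x].
Proof.
split.
  have [i /andP[_ /ltW ix]] := @dD (x - 1) x ltac:(lra).
  by exists (D' i); exists i.
have [j /andP[xj _]] := @dD x (x + 1) ltac:(lra).
by exists (D' j) => _ [i -> ix]; rewrite -oD ltW // (le_lt_trans ix).
Qed.

Lemma extension_ge i x : D i <= x -> D' i <= F x.
Proof. by move=> ix; apply: ub_le_sup; [exact: (has_supF x).2|exists i]. Qed.

Lemma extension_le i x : x <= D i -> F x <= D' i.
Proof.
move=> xi; apply: ge_sup; first exact: (has_supF x).1.
by move=> _ [j -> jx]; rewrite -oD (le_trans jx).
Qed.

Lemma extensionE i : F (D i) = D' i.
Proof. by apply/le_anti; rewrite extension_le // extension_ge. Qed.

(** A single index between [x] and [y] gives a weak inequality only; the second one makes it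
    strict. *)
Lemma extension_lt : {homo F : x y / x < y}.
Proof.
move=> x y xy; have [i /andP[xi iy]] := dD xy.
have [j /andP[ij jy]] := dD iy.
apply: (@le_lt_trans _ _ (D' i)); first exact/extension_le/ltW.
apply: (@lt_le_trans _ _ (D' j)); first by rewrite -same_order_lt.
exact/extension_ge/ltW.
Qed.

End Extension.

(** If the composite moved [x], some [D i] would separate [x] from its image. The composite is
    increasing and fixes [D i], so it preserves the side on which [x] lies. *)
Lemma extensionK D D' : dense_family D -> dense_family D' -> same_order D D' ->
  cancel (extension D D') (extension D' D).
Proof.
move=> dD dD' oD x; have oD' := same_order_sym oD.
set y := extension _ _ x.
have [/dD[i /andP[yi ix]]|/dD[i /andP[xi iy]]|//] := ltgtP (extension D' D y) x.
  have := extension_lt dD oD ix; rewrite extensionE // => /(extension_lt dD' oD').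
  by rewrite extensionE // => /(lt_trans yi); rewrite ltxx.
have := extension_lt dD oD xi; rewrite extensionE // => /(extension_lt dD' oD').
by rewrite extensionE // => /lt_trans/(_ iy); rewrite ltxx.
Qed.

End DenseExtension.

Section IncreasingBijections.
Variable R : realType.
Implicit Types F G : R -> R.

Lemma increasing_mono F : {homo F : x y / x < y} -> {mono F : x y / x < y}.
Proof. by move=> F_lt; apply/leW_mono/le_mono. Qed.

Lemma increasing_cancel F G : {homo F : x y / x < y} -> cancel G F ->
  {homo G : x y / x < y}.
Proof. by move=> F_lt GK x y xy; rewrite -(increasing_mono F_lt) !GK. Qed.

(** The interval of radius [e] around [F x] pulls back to the open interval between the [G]-images
    of its ends. *)
Lemma increasing_bij_continuous F G : {homo F : x y / x < y} -> cancel G F ->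
  continuous F.
Proof.
move=> F_lt GK x; have F_mono := increasing_mono F_lt.
apply/cvgrPdist_lt => e e0.
have l : G (F x - e) < x by rewrite -F_mono GK; lra.
have r : x < G (F x + e) by rewrite -F_mono GK; lra.
have : x \in `]G (F x - e), G (F x + e)[ by rewrite in_itv /= l r.
move=> /near_in_itvoo; apply: filterS => y; rewrite in_itv /= => /andP[ly yr].
move: ly yr; rewrite -F_mono GK -[y < _]F_mono GK => ly yr.
by rewrite ltr_norml; apply/andP; split; lra.
Qed.

End IncreasingBijections.

(** * Descent of increasing bijections to the circle *)

Section CircleHomeo.
Variable R : realType.

Lemma cpt_continuous : continuous (@cpt R).
Proof. exact: pi_continuous. Qed.

Section Descent.
Variables (F : R -> R) (F_cont : continuous F).
Hypothesis F_tau : forall x, F (x + tau) = F x + tau.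

Definition descend (u : S1 R) : S1 R := cpt (F (repr u)).

Lemma cptDtauz (x : R) (n : int) : cpt (x + tau * n%:~R) = cpt x.
Proof.
apply/cptP/intrP; exists n; field; exact: tau_neq0.
Qed.

Lemma descend_cpt x : descend (cpt x) = cpt (F x).
Proof.
have shift (n : nat) y : F (y + tau * n%:R) = F y + tau * n%:R.
  elim: n y => [|n IH] y; first by rewrite !mulr0 !addr0.
  by rewrite -natr1 mulrDr mulr1 addrA F_tau IH addrA.
rewrite /descend; have [[n|n] ->] := repr_cpt x.
  by rewrite [_%:~R]/(n%:R) shift; exact: (cptDtauz _ n).
rewrite -[RHS](cptDtauz _ (Negz n)) NegzE !mulrNz !mulrN; congr cpt.
by rewrite -[in RHS](subrK (tau * n.+1%:R) x) shift addrK.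
Qed.

Lemma descend_continuous : continuous descend.
Proof.
apply/quotient_continuous => x.
have -> : descend \o \pi_(S1 R)%qT = @cpt R \o F by apply/funext => y; exact: descend_cpt.
by apply: continuous_comp; [exact: F_cont|exact: cpt_continuous].
Qed.

End Descent.

Lemma circle_homeo_of_lift (F G : R -> R) :
  {homo F : x y / x < y} -> cancel F G -> cancel G F ->
  (forall x, F (x + tau) = F x + tau) ->
  exists phi : circle_homeo R, homeo_lift phi = F.
Proof.
move=> F_lt FK GK F_tau.
have G_tau x : G (x + tau) = G x + tau by rewrite -{1}(GK x) -F_tau FK.
have F_cont := increasing_bij_continuous F_lt GK.
have G_cont := increasing_bij_continuous (increasing_cancel F_lt GK) FK.
have inv : exists g : S1 R -> S1 R,
    [/\ continuous g, cancel (descend F) g & cancel g (descend F)].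
  exists (descend G); split; first exact: descend_continuous.
    by move=> u; rewrite -(cpt_repr u) !descend_cpt // FK.
  by move=> u; rewrite -(cpt_repr u) !descend_cpt // GK.
exists (CircleHomeo (descend_continuous F_cont F_tau) inv F_cont F_lt F_tau
  (descend_cpt F_tau)).
by [].
Qed.

End CircleHomeo.

(** * Any two tessellations with marked chords are isomorphic *)

Section TessellationIso.
Variables (R : realType) (T : R) (L L' : R -> R -> Prop).
Hypotheses (tL : tessellation T L) (tL' : tessellation T L').
Variables (x0 x1 y0 y1 : R) (Lx : L x0 x1) (Ly : L' y0 y1).

(** [F] extends the matching of equally indexed vertices. Chords are preserved because each is, up
    to rotation, a pair of consecutive vertices of some stage, a property read off from the
    indices. *)
Lemma tessellation_iso : exists F G : R -> R,
  [/\ {homo F : x y / x < y}, cancel F G, cancel G F,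
      forall x, F (x + T) = F x + T & F x0 = y0 /\ F x1 = y1] /\
  forall u v, L u v <-> L' (F u) (F v).
Proof.
pose D (i : nat * int) := vertex T L x0 x1 i.1 i.2.
pose D' (i : nat * int) := vertex T L' y0 y1 i.1 i.2.
have dD : dense_family D.
  by move=> a b /(vertex_dense tL Lx)[n [k h]]; exists (n, k).
have dD' : dense_family D'.
  by move=> a b /(vertex_dense tL' Ly)[n [k h]]; exists (n, k).
have oD : same_order D D' by move=> i j; rewrite !ler_vertex2.
have oD' := same_order_sym oD.
pose F := extension D D'; pose G := extension D' D.
have F_lt : {homo F : x y / x < y} := extension_lt dD oD.
have FK : cancel F G := extensionK dD dD' oD.
have GK : cancel G F := extensionK dD' dD oD'.
have F_mono := increasing_mono F_lt.
have FE n k : F (vertex T L x0 x1 n k) = vertex T L' y0 y1 n k.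
  exact: (extensionE dD oD (n, k)).
pose s (i : nat * int) := (i.1, i.2 + 2 ^+ i.1.+1).
have Ds i : D (s i) = D i + T by exact: vertexDT.
have Ds' i : D' (s i) = D' i + T by exact: vertexDT.
have FD i : F (D i) = D' i by exact: extensionE.
have F_T x : F (x + T) = F x + T.
  (* If the two values differed, a vertex between them, translated by one period through [s], would
     lie on both sides of [x]. *)
  have [|h|//] := ltgtP (F (x + T)) (F x + T).
    rewrite -ltrBlDr => /dD'[i]; rewrite -FD F_mono => /andP[h1 h2].
    by move: h1; rewrite ltrBlDr FD -Ds' -FD F_mono Ds ltrD2r ltNge (ltW h2).
  rewrite -ltrBrDr in h; have [i] := dD' _ _ h; rewrite -FD F_mono => /andP[h1].
  by rewrite ltrBrDr FD -Ds' -FD F_mono Ds ltrD2r ltNge (ltW h1).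
exists F, G; split; first split=> //.
  have := FE 0%N (0 * 2); have := FE 0%N (0 * 2 + 1).
  by rewrite !vertex0_even !vertex0_odd !mulr0 !addr0.
move=> u v; split=> [/(vertex_exhaust tL Lx)[n [k [[-> ->]|[-> uE]]]]|].
- by rewrite !FE; exact: vertex_chord.
- apply: (tess_rotate tL' _ _).2; rewrite -F_T uE !FE; exact: vertex_chord.
move=> /(vertex_exhaust tL' Ly)[n [k [[uE vE]|[vE uE]]]].
  rewrite -(FK u) -(FK v) uE vE -!FE !FK; exact: vertex_chord.
apply: (tess_rotate tL _ _).2; rewrite -(FK v) -(FK (u + T)) F_T uE vE -!FE !FK.
exact: vertex_chord.
Qed.

End TessellationIso.

(** * Clusters as tessellations *)

Section PhiStable.
Variables (K : fieldType) (R : realType) (phi : circle_homeo R).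
Implicit Types X Y : fobj K R.

(** The homotopy criterion reduces this to functoriality, with no need to transport
    projective-injective objects. *)
Lemma Phi_stably_null X Y (f : phom K X Y) : fmor f -> stably_null f ->
  @stably_null K R (Phi phi X) (Phi phi Y) (Phi_phom phi f).
Proof.
move=> fm /(stably_nullP fm)[b fE].
apply/(@stably_nullP K R (Phi phi X) (Phi phi Y)); first exact: Phi_fmor.
exists (Phi_phom phi b); rewrite -[fdiff (Phi phi X)]/(Phi_phom phi (fdiff X)).
rewrite -[fdiff (Phi phi Y)]/(Phi_phom phi (fdiff Y)) -!Phi_comp !Phi_phomE.
by rewrite {1}fE.
Qed.

Lemma Phi_stable_iso X Y : stable_iso X Y -> stable_iso (Phi phi X) (Phi phi Y).
Proof.
have H (A B : fobj K R) (f : phom K A B) (g : phom K B A) : fmor f -> fmor g ->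
    stably_null (pcomp g f - pid A) ->
    @stably_null K R (Phi phi A) (Phi phi A)
      (pcomp (Phi_phom phi g) (Phi_phom phi f) - pid (Phi phi A)).
  move=> fm gm n; have nm : @fmor K R A A (pcomp g f - pid A).
    rewrite /fmor pcompDl pcompDr pcompNl pcompNr pcomp1f pcompf1.
    by congr (_ - _); apply: fmor_comp.
  have := Phi_stably_null nm n; rewrite -Phi_comp.
  by rewrite -[pid (Phi phi A)]/(pid (Phi_pobj phi A)) -Phi_id !Phi_phomE.
move=> [f [g [fm gm gf fg]]].
exists (Phi_phom phi f), (Phi_phom phi g).
by split; [exact: Phi_fmor|exact: Phi_fmor|exact: H|exact: H].
Qed.

Lemma Phi_chord u v : u < v < u + tau ->
  Phi phi (chord K u v) = chord K (homeo_lift phi u) (homeo_lift phi v).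
Proof.
move=> /andP[uv vu]; have h : u <= v <= u + tau by rewrite !ltW.
rewrite (chordE _ h) // Phi_E (chordE _ (lift_bounds phi h)) //.
by rewrite -lift_tau; exact: lift_increasing.
Qed.

End PhiStable.

Section ClusterTessellation.
Variables (K : fieldType) (R : realType).
Implicit Types (u v x y : R) (T : set (fobj K R)).

Lemma cpt_neq u v : u < v < u + tau -> cpt u <> cpt v.
Proof.
move=> /andP[uv vu] /cptP/intrP[n]; have t0 := tau_gt0 R => E.
have : (-1)%:~R < n%:~R :> R by rewrite -E ltr_pdivlMr //; lra.
have : n%:~R < 0%:~R :> R by rewrite -E ltr_pdivrMr //; lra.
by rewrite !ltr_int; lia.
Qed.

Definition endpoints u v (h : u < v < u + tau) : @off_diagonal R :=
  exist _ (cpt u, cpt v) (mem_set (cpt_neq h : off_diagonal (cpt u, cpt v))).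

Lemma circle_lift w (s : S1 R) : exists x, cpt x = s /\ w <= x < w + tau.
Proof.
exists (w + rem2pi (repr s - w)); split.
  rewrite -[RHS]cpt_repr -[RHS](cptDtauz _ (- Num.floor ((repr s - w) / tau))).
  by congr cpt; rewrite /rem2pi mulrNz; ring.
by rewrite lerDl rem2pi_ge0 ltrD2l rem2pi_lt.
Qed.

Lemma class_ofP (p q : @off_diagonal R) :
  class_of K p = class_of K q <-> stable_iso (E_pair K (\val p)) (E_pair K (\val q)).
Proof.
split=> [/(@eqmodP _ (same_class_equiv K R))/asboolP//|pq].
by apply/(@eqmodP _ (same_class_equiv K R))/asboolP.
Qed.

(** Membership up to stable isomorphism makes the relation invariant under rotation, although [T]
    contains one object per class. *)
Definition lifted_chords T u v :=
  u < v < u + tau /\ exists2 X, T X & stable_iso X (chord K u v).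

Lemma indecomposable_chord X : indecomposable X ->
  exists u v, u < v < u + tau /\ X = chord K u v.
Proof.
move=> [u [v [h [uv ->]]]]; exists u, v; split=> //.
by rewrite chordE //; case/andP: uv.
Qed.

Lemma lifted_chordsP T u v (h : u < v < u + tau) : is_cluster T ->
  lifted_chords T u v <-> classes_of T (class_of K (endpoints h)).
Proof.
move=> [Tind _ _]; split=> [[_ [X TX iso]]|[p Tp /class_ofP pE]].
  have [x [y [xy XE]]] := indecomposable_chord (Tind _ TX); subst X.
  by exists (endpoints xy) => //; apply/class_ofP.
by split=> //; exists (E_pair K (\val p)).
Qed.

Lemma lifted_chords_rotate T u v :
  lifted_chords T u v <-> lifted_chords T v (u + tau).
Proof.
split=> [[uv [X TX iso]]|[uv [X TX iso]]].
  split; first by move/andP: uv => [? ?]; apply/andP; split; lra.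
  by exists X => //; apply: stable_iso_trans iso (chord_rotate K uv).
have {}uv : u < v < u + tau by move/andP: uv => [? ?]; apply/andP; split; lra.
split=> //; exists X => //; apply: stable_iso_trans iso _.
exact/stable_iso_sym/chord_rotate.
Qed.

Lemma lifted_chords_noncrossing T u v x y : is_cluster T ->
  lifted_chords T u v -> lifted_chords T x y ->
  u < x -> x < v -> v < y -> y < u + tau -> False.
Proof.
move=> cT Tuv Txy ux xv vy yu; have [_ _ [comp _ _]] := cT.
apply: (crossing_incompatible ux xv vy yu).
apply: (comp (endpoints Tuv.1) (endpoints Txy.1)); exact/lifted_chordsP.
Qed.

(** A chord that crosses no member is compatible with all of them, so its class can be added to the
    cluster, which by maximality contains it already. *)
Lemma lifted_chords_maximal T u v : is_cluster T -> u < v < u + tau ->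
  (forall x y, lifted_chords T x y ->
    u < x -> x < v -> v < y -> y < u + tau -> False) ->
  lifted_chords T u v.
Proof.
move=> cT uv nc; have [_ _ [comp max _]] := cT; have /andP[uv1 uv2] := uv.
have near a b : u <= a -> a < b -> b < u + tau -> lifted_chords T a b ->
    compatible (chord K u v) (chord K a b).
  move=> ua ab bu Tab.
  have [bv|vb] := leP b v; first exact: nested_compatible.
  have rot := chord_rotate K uv.
  have [va|av] := leP v a.
    apply: compatible_iso (stable_iso_sym rot) (stable_iso_refl _) _.
    by apply: nested_compatible; lra.
  have [ua'|au] := ltP u a; first by case: (nc _ _ Tab).
  have -> : a = u by lra.
  have ub : u < b < u + tau by apply/andP; split; lra.
  apply: compatible_iso (stable_iso_sym rot)
    (stable_iso_sym (chord_rotate K ub)) _.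
  by apply: nested_compatible; lra.
(* Both points are lifted to [[u, u + tau[]; if the lifts come in the wrong order, a rotation
   exchanges them. *)
have key (q : @off_diagonal R) : classes_of T (class_of K q) ->
    compatible (chord K u v) (E_pair K (\val q)).
  case: q => -[s t] st; rewrite [\val _]/= => Tq.
  have ne : s <> t by have := set_mem st.
  have [a [aE /andP[ua au]]] := circle_lift u s.
  have [b [bE /andP[ub bu]]] := circle_lift u t.
  have [p Tp /class_ofP pE] := Tq; rewrite [\val (exist _ _ _)]/= in pE.
  move: pE ne {Tq st}; rewrite -aE -bE -[E_pair K (cpt a, _)]/(chord K a b) => pE ne.
  have [ab|ba|abE] := ltgtP a b; last by case: ne; rewrite abE.
    apply: near => //; split; first by apply/andP; split; lra.
    by exists (E_pair K (\val p)).
  have hba : b < a < b + tau by apply/andP; split; lra.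
  have ro : stable_iso (chord K b a) (chord K a b).
    by have := chord_rotate K hba; rewrite /chord cptDtau.
  apply: (compatible_iso (stable_iso_refl _) ro); apply: near => //.
  split=> //; exists (E_pair K (\val p)) => //.
  exact: stable_iso_trans pE (stable_iso_sym ro).
apply/(lifted_chordsP uv cT).
pose c := class_of K (endpoints uv).
rewrite -(max (classes_of T `|` [set c])); [by right| |by left].
move=> p q [Tp|/class_ofP pE] [Tq|/class_ofP qE].
- exact: comp.
- apply/compatible_sym/(compatible_iso (stable_iso_sym qE) (stable_iso_refl _)).
  exact: key.
- apply: compatible_iso (stable_iso_sym pE) (stable_iso_refl _) _.
  exact: key.
- by apply: Or33; apply: stable_iso_trans pE (stable_iso_sym qE).
Qed.

(** This is continuity of the passage from lifted endpoints to classes, through [cpt] in each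
    coordinate, the subspace [off_diagonal] and the quotient map. *)
Lemma nbhs_endpoints u v (h : u < v < u + tau) (V : set (classM K R)) :
  nbhs (class_of K (endpoints h)) V -> exists2 e, 0 < e & forall x y
    (h' : x < y < x + tau), `|x - u| < e -> `|y - v| < e ->
    V (class_of K (endpoints h')).
Proof.
have class_cont : continuous (@class_of K R).
  exact: (@pi_continuous _ {eq_quot same_class_equiv K R}%qT).
move=> /class_cont.
move=> [_ [[W oW <-] /= Wh WV]].
have [[A B] /= [nA nB] ABW] : nbhs (cpt u, cpt v) W by exact: open_nbhs_nbhs.
have /nbhs_ballP[d /= d0 dA] := cpt_continuous nA.
have /nbhs_ballP[e /= e0 eB] := cpt_continuous nB.
exists (Num.min d e); first by rewrite lt_min d0.
move=> x y h'; rewrite !lt_min => /andP[xu _] /andP[_ yv]; apply: WV.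
apply: (ABW (cpt x, cpt y)); split; [apply: dA|apply: eB].
  by rewrite /ball /= distrC.
by rewrite /ball /= distrC.
Qed.

Lemma lifted_chords_discrete T u v : is_cluster T -> lifted_chords T u v ->
  exists2 e, 0 < e & forall x y, lifted_chords T x y ->
    `|x - u| < e -> `|y - v| < e -> x = u /\ y = v.
Proof.
move=> cT Tuv; have [_ _ [_ _ disc]] := cT; have uv := Tuv.1.
have /(disc _)[_ [V /(nbhs_endpoints)[e e0 eV] VE]] := (lifted_chordsP uv cT).1 Tuv.
have /andP[uv1 uv2] := uv.
(* The last two bounds put [x] in [(v - tau, v)] and [y] in [(u, u + tau)], where isomorphic chords
   have equal lifts. *)
exists (Num.min e (Num.min (v - u) (u + tau - v))).
  by rewrite !lt_min e0 !subr_gt0 uv1.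
move=> x y Txy; rewrite !lt_min => /and3P[xe + +] /and3P[ye + +].
rewrite !ltr_norml => /andP[? ?] /andP[? ?] /andP[? ?] /andP[? ?].
have xy := Txy.1; have /andP[? ?] := xy.
have iso : stable_iso (chord K u v) (chord K x y).
  have : (V `&` classes_of T) (class_of K (endpoints xy)).
    by split; [exact: eV|exact/lifted_chordsP].
  by rewrite VE => /esym/class_ofP.
have uv' : v < u + tau < v + tau by apply/andP; split; lra.
have xy' : y < x + tau < y + tau by apply/andP; split; lra.
split; first by apply: (chord_iso_eq uv xy _ iso); apply/andP; split; lra.
apply: (chord_iso_eq uv' xy'); first by apply/andP; split; lra.
apply: stable_iso_trans (stable_iso_trans iso (chord_rotate K xy)).
exact/stable_iso_sym/chord_rotate.
Qed.

Lemma cluster_tessellation T : is_cluster T -> tessellation tau (lifted_chords T).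
Proof.
move=> cT; split.
- by move=> u v [].
- exact: lifted_chords_rotate.
- by move=> u v x y; exact: lifted_chords_noncrossing.
- by move=> u v; exact: lifted_chords_maximal.
- by move=> u v; exact: lifted_chords_discrete.
Qed.

End ClusterTessellation.

Theorem theorem4p2p1 (R : realType) (K : fieldType) (T1 T2 : set (fobj K R))
    (hT1 : is_cluster T1) (hT2 : is_cluster T2) (X1 X2 : fobj K R)
    (hX1 : T1 X1) (hX2 : T2 X2) :
  exists phi : circle_homeo R,
    same_up_to_iso (Phi phi @` T1) T2 /\ Phi phi X1 = X2.
Proof.
have chord_of (T : set (fobj K R)) X : is_cluster T -> T X ->
    exists u v, X = chord K u v /\ lifted_chords T u v.
  move=> [Tind _ _] TX; have [u [v [uv XE]]] := indecomposable_chord (Tind _ TX).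
  exists u, v; split=> //; split=> //; exists X => //.
  by rewrite XE; exact: stable_iso_refl.
have [x0 [x1 [X1E Lx]]] := chord_of _ _ hT1 hX1.
have [y0 [y1 [X2E Ly]]] := chord_of _ _ hT2 hX2.
have [F [G [[F_lt FK GK F_tau [F0 F1]] FL]]] :=
  tessellation_iso (cluster_tessellation hT1) (cluster_tessellation hT2) Lx Ly.
have [phi phiF] := circle_homeo_of_lift F_lt FK GK F_tau.
have PhiE u v : u < v < u + tau -> Phi phi (chord K u v) = chord K (F u) (F v).
  by move=> uv; rewrite Phi_chord // phiF.
(* The marked objects match exactly, since [X1] and [X2] are equal to chords and [F] sends the
   lifted ends of one to those of the other. *)
exists phi; split; last by rewrite X1E X2E PhiE ?F0 ?F1 //; exact: Lx.1.
split=> [_ [X TX <-]|Y TY].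
  have [u [v [-> Luv]]] := chord_of _ _ hT1 TX.
  have /FL[_ [Y TY YE]] := Luv; exists Y => //.
  by rewrite PhiE; [exact: stable_iso_sym|exact: Luv.1].
have [u [v [-> Luv]]] := chord_of _ _ hT2 TY.
have : lifted_chords T1 (G u) (G v) by apply/FL; rewrite !GK.
move=> [uv [X TX iso]]; exists (Phi phi X); first by exists X.
by have := Phi_stable_iso phi iso; rewrite PhiE // !GK.
Qed.
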